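(* Let $d\ge 2$, let $\mu_0\in\mathbb{R}^d$ and let $A_0\in\mathbb{R}^{d\times d}$ be symmetric with $(A_0)_{d,d}=0$. Let $X_1,X_2,\ldots$ be i.i.d. random vectors on a probability space $(\Omega,\mathcal{F},\mathbb{P})$ with the Fisher-Bingham distribution $FB(\mu_0,A_0)$ on $\mathcal{S}^{d-1}$. Let $f_1:\mathcal{S}^{d-1}\to\mathbb{R}^d$ and $f_2:\mathcal{S}^{d-1}\to\mathbb{R}^{d(d+1)/2-1}$ be test functions all of whose components are smooth, and let $M_n',D_n,E_n,G_n',H_n,L_n$ be the associated sample quantities and $\hat\theta_n=(\hat\mu_n,\hat A_n)$ the associated Stein estimator, as defined in the context. Suppose that the matrices $\mathbb{E}[M_1']$ and $\mathbb{E}[L_1]-\mathbb{E}[G_1']\,\mathbb{E}[M_1']^{-1}\,\mathbb{E}[E_1]$ are invertible. Then the probability that $\hat\theta_n$ exists converges to one as $n\to\infty$, and $\hat\theta_n$ is strongly consistent in the following sense: there is a set $\Omega'\subset\Omega$ with $\mathbb{P}(\Omega')=1$ such that for each $\omega\in\Omega'$ there is an $N\in\mathbb{N}$ such that $\hat\theta_n(\omega)$ exists for each $n\ge N$, and $$(\hat\mu_n,\hat A_n)(\omega)\longrightarrow(\mu_0,A_0)\quad\text{as } n\to\infty.$$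
   Context: $\mathcal{S}^{d-1}=\{x\in\mathbb{R}^d: x^\top x=1\}$, with surface area measure $\sigma_{d-1}$. For $\mu\in\mathbb{R}^d$ and symmetric $A\in\mathbb{R}^{d\times d}$ with $A_{d,d}=0$ (an identifiability restriction), the Fisher-Bingham distribution $FB(\mu,A)$ has density $p_\theta(x)=C(\mu,A)^{-1}\exp(\mu^\top x+x^\top A x)$, $x\in\mathcal{S}^{d-1}$, with respect to $\sigma_{d-1}$, where $\theta=(\mu,A)$ and $C(\mu,A)=\int_{\mathcal{S}^{d-1}}\exp(\mu^\top x+x^\top Ax)\,\sigma_{d-1}(dx)$. Differential operators: each smooth function on $\mathcal{S}^{d-1}$ is extended to a smooth function on an open set of $\mathbb{R}^d$ containing $\mathcal{S}^{d-1}$, and derivatives are the Euclidean derivatives of that extension (the quantities defined below do not depend on the choice of extension). For $f=(f^{(1)},\ldots,f^{(m)}):\mathcal{S}^{d-1}\to\mathbb{R}^m$: $\nabla f(x)\in\mathbb{R}^{m\times d}$ is the Jacobian matrix; $\nabla^2 f(x)\in\mathbb{R}^{m\times d^2}$ is the matrix whose $j$-th row is the vectorized Hessian of $f^{(j)}$; $\Delta f(x)\in\mathbb{R}^m$ is the componentwise Euclidean Laplacian. Notation: $I_d$ is the identity matrix, $\otimes$ the Kronecker product, $\mathrm{vec}$ stacks the columns of a matrix, and $\mathrm{vech}(S)\in\mathbb{R}^{d(d+1)/2}$ stacks, column by column, the entries on and below the diagonal of a symmetric $S\in\mathbb{R}^{d\times d}$ (so its last component is $S_{d,d}$). $\mathrm{vech}'(S)\in\mathbb{R}^{d(d+1)/2-1}$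 is $\mathrm{vech}(S)$ without its last component. $\mathbf{D}\in\mathbb{R}^{d^2\times d(d+1)/2}$ is the duplication matrix: $\mathbf{D}\,\mathrm{vech}(S)=\mathrm{vec}(S)$ for all symmetric $S$. For a function $g$ on $\mathcal{S}^{d-1}$, $\overline{g(X)}=n^{-1}\sum_{i=1}^n g(X_i)$. Define $M_n=2\,\overline{\big((\nabla f_2(X)(I_d-XX^\top))\otimes X^\top\big)\mathbf{D}}\in\mathbb{R}^{(d(d+1)/2-1)\times d(d+1)/2}$, $D_n=\overline{(d-1)\nabla f_2(X)X+\nabla^2f_2(X)(X\otimes X)-\Delta f_2(X)}\in\mathbb{R}^{d(d+1)/2-1}$, $E_n=\overline{\nabla f_2(X)(I_d-XX^\top)}\in\mathbb{R}^{(d(d+1)/2-1)\times d}$, $G_n=2\,\overline{\big((\nabla f_1(X)(I_d-XX^\top))\otimes X^\top\big)\mathbf{D}}\in\mathbb{R}^{d\times d(d+1)/2}$, $H_n=\overline{(d-1)\nabla f_1(X)X+\nabla^2f_1(X)(X\otimes X)-\Delta f_1(X)}\in\mathbb{R}^d$, $L_n=\overline{\nabla f_1(X)(I_d-XX^\top)}\in\mathbb{R}^{d\times d}$. $M_n'$ and $G_n'$ are $M_n$ and $G_n$ without their last columns. $M_1',E_1,G_1',L_1$ denote these quantities for $n=1$, i.e. evaluated at the single observation $X_1$. The Stein estimator $\hat\theta_n=(\hat\mu_n,\hat A_n)$ is defined by $$\hat\mu_n=(L_n-G_n'(M_n')^{-1}E_n)^{-1}(H_n-G_n'(M_n')^{-1}D_n),\qquad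 \mathrm{vech}'(\hat A_n)=(M_n')^{-1}(D_n-E_n\hat\mu_n),$$ with $\hat A_n$ symmetric and $(\hat A_n)_{d,d}=0$. It is said to exist when the matrices inverted in these formulas, $M_n'$ and $L_n-G_n'(M_n')^{-1}E_n$, are invertible. *)

(* Defs.v *)
From HB Require Import structures.
From mathcomp Require Import all_boot all_order all_algebra.
From mathcomp.real_closed Require Import mxtens.
From mathcomp Require Import all_classical all_reals all_analysis measurable_realfun.

Set Implicit Arguments.
Unset Strict Implicit.
Unset Printing Implicit Defensive.

Import Order.TTheory GRing.Theory Num.Theory.
Import numFieldTopology.Exports numFieldNormedType.Exports.

Local Open Scope classical_set_scope.
Local Open Scope ring_scope.


Definition measure_cV_display : measure_display -> measure_display.
Proof. exact. Qed.

Section measurable_cV.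
Context {d} {T : measurableType d}.
Variable n : nat.

Definition cV_coord (i : 'I_n) (x : 'cV[T]_n) : T := x i ord0.

Let cV_set0 : g_sigma_preimage cV_coord set0.
Proof. exact: sigma_algebra0. Qed.

Let cV_setC A : g_sigma_preimage cV_coord A -> g_sigma_preimage cV_coord (~` A).
Proof. exact: sigma_algebraC. Qed.

Let cV_bigcup (F : _^nat) : (forall i, g_sigma_preimage cV_coord (F i)) ->
  g_sigma_preimage cV_coord (\bigcup_i (F i)).
Proof. exact: sigma_algebra_bigcup. Qed.

HB.instance Definition _ := @isMeasurable.Build (measure_cV_display d)
  'cV[T]_n (g_sigma_preimage cV_coord) cV_set0 cV_setC cV_bigcup.

End measurable_cV.

Section measurable_cV_theory.
Context d1 d2 (T1 : measurableType d1) (T2 : measurableType d2).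

Lemma measurable_fun_cVP n (f : T1 -> 'cV[T2]_n) :
  measurable_fun [set: T1] f <->
  forall i, measurable_fun [set: T1] (fun x => f x i ord0).
Proof.
apply: (@iff_trans _ (g_sigma_preimage
    (fun i : 'I_n => cV_coord i \o f) `<=` measurable)).
  rewrite g_sigma_preimage_comp; split=> [mf A [/= C preC <-]|prefS].
    exact: mf.
  by move=> _ A mA; apply: prefS; exists A.
split=> [tnthfS i|mf].
- move=> _ A mA.
  apply: tnthfS; apply: sub_sigma_algebra.
  case: n i => [[] []//|m i] in f *.
  rewrite -bigcup_mkord_ord.
  exists i; first exact: ltn_ord.
  by exists A => //; rewrite inord_val.
- apply: smallest_sub; first exact: sigma_algebra_measurable.
  case: n => [|m] in f mf *; first by rewrite big_ord0.
  rewrite -bigcup_mkord_ord; apply: bigcup_sub => i Ii.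
  by move=> A [B mB <-]; exact: mf.
Qed.

End measurable_cV_theory.

Lemma measurable_cV_coord d (T : measurableType d) n (i : 'I_n) :
  measurable_fun [set: 'cV[T]_n] (fun x : 'cV[T]_n => x i ord0).
Proof. exact: (measurable_fun_cVP (@id 'cV[T]_n)).1. Qed.

Lemma sigma_finite_product d1 d2 (T1 : measurableType d1)
    (T2 : measurableType d2) (R : realType)
    (m1 : {sigma_finite_measure set T1 -> \bar R})
    (m2 : {sigma_finite_measure set T2 -> \bar R}) :
  sigma_finite setT (m1 \x m2)%E.
Proof.
have /sigma_finiteP[F [TF ndF Foo]] := sigma_finiteT m1.
have /sigma_finiteP[G [TG ndG Goo]] := sigma_finiteT m2.
exists (fun n => F n `*` G n).
  rewrite -setXTT TF TG predeqE => -[x y]; split; last first.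
    by move=> [n _ []/= ? ?]; split; exists n.
  move=> [/= [n _ Fnx] [k _ Gky]]; exists (maxn n k) => //; split.
  - by move: x Fnx; exact/subsetPset/ndF/leq_maxl.
  - by move: y Gky; exact/subsetPset/ndG/leq_maxr.
move=> k; have [? ?] := Foo k; have [? ?] := Goo k.
split; first exact: measurableX.
by rewrite product_measure1E// lte_mul_pinfty// ge0_fin_numE.
Qed.

Section lebesgue_cV.
Variable R : realType.

Definition cV_cons n (p : R * 'cV[R]_n) : 'cV[R]_n.+1 :=
  col_mx (p.1%:M : 'cV_1) p.2.

Definition cV_uncons n (x : 'cV[R]_n.+1) : R * 'cV[R]_n :=
  (x ord0 ord0, dsubmx (x : 'cV_(1 + n))).

Lemma cV_consK n : cancel (@cV_cons n) (@cV_uncons n).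
Proof.
move=> [a v]; rewrite /cV_cons /cV_uncons col_mxKd mxE; congr pair.
by case: splitP => j // _; rewrite ord1 mxE eqxx mulr1n.
Qed.

Lemma measurable_cV_cons n : measurable_fun setT (@cV_cons n).
Proof.
apply/measurable_fun_cVP => i.
have -> : i = unsplit (@fintype.split 1 n i) by rewrite splitK.
case: (@fintype.split 1 n i) => j /=.
- rewrite [X in measurable_fun _ X](_ : _ = fst); first exact: measurable_fst.
  by apply/funext => p; rewrite [LHS](@col_mxEu R 1 n 1) ord1 mxE eqxx mulr1n.
- rewrite [X in measurable_fun _ X](_ : _ =
    (fun x : 'cV[R]_n => x j ord0) \o snd).
    exact: measurableT_comp (measurable_cV_coord j) measurable_snd.
  by apply/funext => p; rewrite [LHS](@col_mxEd R 1 n 1).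
Qed.

Lemma measurable_cV_uncons n : measurable_fun setT (@cV_uncons n).
Proof.
apply/measurable_fun_pair; first exact: measurable_cV_coord.
apply/measurable_fun_cVP => i.
rewrite [X in measurable_fun _ X](_ : _ =
  (fun x : 'cV[R]_n.+1 => x (rshift 1 i) ord0)).
  exact: measurable_cV_coord.
by apply/funext => x; rewrite mxE.
Qed.

Section cons_measure.
Variables (n : nat) (mu : {sigma_finite_measure set 'cV[R]_n -> \bar R}).

Definition cons_measure : set 'cV[R]_n.+1 -> \bar R :=
  pushforward (@lebesgue_measure R \x mu)%E (@cV_cons n).

Let cons_measure0 : cons_measure set0 = 0%E.
Proof. by rewrite /cons_measure /pushforward preimage_set0 measure0. Qed.

Let cons_measure_ge0 A : (0 <= cons_measure A)%E.
Proof. by rewrite /cons_measure /pushforward measure_ge0. Qed.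

Let cons_measure_sigma_additive : semi_sigma_additive cons_measure.
Proof.
pose m' := measure_function_pushforward__canonical__measure_function_Measure
  (@lebesgue_measure R \x mu)%E (@measurable_cV_cons n).
exact: (@measure_semi_sigma_additive _ _ _ m').
Qed.

HB.instance Definition _ := isMeasure.Build _ _ _ cons_measure
  cons_measure0 cons_measure_ge0 cons_measure_sigma_additive.

Let cons_measure_sigma_finite : sigma_finite setT cons_measure.
Proof.
have [F FT mF] := sigma_finite_product (@lebesgue_measure R) mu.
exists (fun k => @cV_uncons n @^-1` F k).
  by rewrite -preimage_bigcup -FT preimage_setT.
move=> k; have [mFk Fk] := mF k; split.
  by rewrite -[X in measurable X]setTI; exact: measurable_cV_uncons.
rewrite /cons_measure /pushforward -comp_preimage.
by rewrite (_ : _ \o _ = id) ?preimage_id//; apply/funext; exact: cV_consK.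
Qed.

HB.instance Definition _ := Measure_isSigmaFinite.Build _ _ _ cons_measure
  cons_measure_sigma_finite.

End cons_measure.

Fixpoint lebesgue_cV n : {sigma_finite_measure set 'cV[R]_n -> \bar R} :=
  match n with
  | 0 => dirac (0 : 'cV[R]_0)
  | m.+1 => cons_measure (lebesgue_cV m)
  end.

Lemma lebesgue_cV_box n (A : 'I_n -> set R) :
  (forall i, measurable (A i)) ->
  lebesgue_cV n [set x | forall i, A i (x i ord0)] =
  (\prod_(i < n) lebesgue_measure (A i))%E.
Proof.
elim: n A => [|n IH] A mA.
  by rewrite big_ord0 /= diracE mem_set//; case.
rewrite big_ord_recl /= /cons_measure /pushforward -IH//.
have mB : measurable [set v : 'cV[R]_n | forall i, A (lift ord0 i) (v i ord0)].
  rewrite [X in measurable X](_ : _ = \bigcap_(i in [set: 'I_n])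
      ((fun x : 'cV[R]_n => x i ord0) @^-1` A (lift ord0 i))).
    apply: fin_bigcap_measurable => // i _.
    by rewrite -[X in measurable X]setTI; exact: measurable_cV_coord.
  by apply/seteqP; split => x /= Ax i; [move=> _|]; exact: Ax.
rewrite -product_measure1E//; last exact: mA.
congr (product_measure1 _ _ _); apply/seteqP; split => [[a v]|[a v]] /=.
- move=> Ax; split=> [|i]; [have := Ax ord0|have := Ax (lift ord0 i)].
  + by rewrite /cV_cons mxE; case: splitP => // j _; rewrite ord1 mxE eqxx mulr1n.
  + rewrite /cV_cons mxE; case: splitP => j /=; first by rewrite ord1.
    by rewrite /bump /= !add1n => -[/val_inj ->].
- move=> [Aa Av] i; rewrite /cV_cons mxE; case: splitP => j ij.
    have -> : i = ord0 by apply: val_inj; rewrite /= ij ord1.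
    by rewrite ord1 mxE eqxx mulr1n.
  have -> : i = lift ord0 j by exact: val_inj.
  exact: Av.
Qed.

End lebesgue_cV.


Section sphere.
Variables (R : realType) (d : nat).
Implicit Types (x : 'cV[R]_d) (B : set 'cV[R]_d).

Definition sphere : set 'cV[R]_d := [set x | x^T *m x = 1%:M].

Definition cone B : set 'cV[R]_d :=
  [set y | exists r x, [/\ 0 < r <= 1, sphere x, B x & y = r *: x]].

(* The surface area measure of [B `&` sphere], from the polar-coordinate
   formula: the solid cone over a piece of the sphere has volume equal to its
   area divided by [d]. It is carried by [sphere] but defined on all of R^d. *)
Definition surface_measure B : \bar R := (d%:R%:E * lebesgue_cV R d (cone B))%E.

Let sqn x := \sum_i x i ord0 ^+ 2.
Let unitv x := (Num.sqrt (sqn x))^-1 *: x.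
Let shell : set 'cV[R]_d := [set x | 0 < sqn x <= 1].

Let sqnE x : x^T *m x = (sqn x)%:M.
Proof.
apply/matrixP => i j; rewrite !ord1 !mxE eqxx mulr1n.
by apply: eq_bigr => k _; rewrite mxE expr2.
Qed.

Let sphereE x : sphere x <-> sqn x = 1.
Proof.
rewrite /sphere /= sqnE; split=> [/matrixP/(_ ord0 ord0)|->//].
by rewrite !mxE eqxx !mulr1n.
Qed.

Let sqn_ge0 x : 0 <= sqn x.
Proof. by apply: sumr_ge0 => i _; rewrite sqr_ge0. Qed.

Let sqnZ r x : sqn (r *: x) = r ^+ 2 * sqn x.
Proof. by rewrite /sqn mulr_sumr; apply: eq_bigr => i _; rewrite mxE exprMn. Qed.

Let measurable_sqn : measurable_fun [set: 'cV[R]_d] sqn.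
Proof.
by apply: measurable_sum => i; apply: measurable_funX; exact: measurable_cV_coord.
Qed.

Let measurable_unitv : measurable_fun setT unitv.
Proof.
apply/measurable_fun_cVP => i.
rewrite [X in measurable_fun _ X](_ : _ =
  (fun x => (sqn x) `^ (- 2^-1) * x i ord0)).
  apply: measurable_funM; last exact: measurable_cV_coord.
  exact: (measurableT_comp (measurable_powR (- 2^-1)) measurable_sqn).
by apply/funext => x; rewrite mxE powRN powR12_sqrt.
Qed.

Let measurable_shell : measurable shell.
Proof.
rewrite (_ : shell = sqn @^-1` `]0, 1]%classic).
  by rewrite -[X in measurable X]setTI; exact: measurable_sqn.
by apply/seteqP; split => x /=; rewrite in_itv.
Qed.

Let coneE B : cone B = unitv @^-1` B `&` shell.
Proof.
apply/seteqP; split => [y [r [x [/andP[r0 r1] /sphereE x1 Bx ->]]]|y [By /andP[y0 y1]]].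
  rewrite /preimage /shell /= /unitv sqnZ x1 mulr1 sqrtr_sqr gtr0_norm//.
  rewrite scalerA mulVf ?gt_eqF// scale1r exprn_gt0//=; split => //.
  by rewrite expr_le1 // ltW.
have s0 : 0 < Num.sqrt (sqn y) by rewrite sqrtr_gt0.
exists (Num.sqrt (sqn y)), (unitv y); split => //.
- by rewrite s0 -sqrtr1 ler_wsqrtr.
- by apply/sphereE; rewrite sqnZ exprVn sqr_sqrtr// mulVf ?gt_eqF.
- by rewrite /unitv scalerA divff ?scale1r ?gt_eqF.
Qed.

Let surface_measure0 : surface_measure set0 = 0%E.
Proof. by rewrite /surface_measure coneE preimage_set0 set0I measure0 mule0. Qed.

Let surface_measure_ge0 B : (0 <= surface_measure B)%E.
Proof. by rewrite mule_ge0. Qed.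

Let surface_measure_sigma_additive : semi_sigma_additive surface_measure.
Proof.
move=> F mF tF mUF; rewrite /surface_measure.
rewrite [X in X @ _ --> _](_ : _ = fun n =>
    (d%:R%:E * \sum_(0 <= i < n) lebesgue_cV R d (cone (F i)))%E); last first.
  by apply/funext => n; rewrite ge0_sume_distrr.
apply: cvgeZl => //.
rewrite [cone _](_ : _ = \bigcup_i cone (F i)); last first.
  rewrite coneE preimage_bigcup setI_bigcupl.
  by apply: eq_bigcupr => i _; rewrite coneE.
have mc i : measurable (cone (F i)).
  rewrite coneE; apply: measurableI => //.
  by rewrite -[X in measurable X]setTI; exact: measurable_unitv.
apply: measure_semi_sigma_additive => //; last exact: bigcup_measurable.
apply/trivIsetP => i j _ _ ij; rewrite !coneE setIACA -preimage_setI.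
by move/trivIsetP : tF => /(_ _ _ I I ij) ->; rewrite preimage_set0 set0I.
Qed.

HB.instance Definition _ := isMeasure.Build _ _ _ surface_measure
  surface_measure0 surface_measure_ge0 surface_measure_sigma_additive.

End sphere.
Arguments sphere {R d}.
Arguments surface_measure {R d}.


Section fisher_bingham.
Variables (R : realType) (d : nat) (mu : 'cV[R]_d) (A : 'M[R]_d).

Definition FB_kernel (x : 'cV[R]_d) : R :=
  expR ((mu^T *m x + x^T *m A *m x) ord0 ord0).

Definition FB_const : R := Rintegral surface_measure sphere FB_kernel.

Definition FB_density (x : 'cV[R]_d) : R := FB_const^-1 * FB_kernel x.

Definition FB (B : set 'cV[R]_d) : \bar R :=
  (\int[surface_measure]_(x in sphere `&` B) (FB_density x)%:E)%E.

End fisher_bingham.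

Definition FB_admissible (R : realType) (d : nat) (A : 'M[R]_d) : Prop :=
  A^T = A /\ forall i : 'I_d, i.+1 = d -> A i i = 0.

Section independence.
Context dO (Omega : measurableType dO) (R : realType) (P : probability Omega R).
Context dT (T : measurableType dT).

Definition mutually_independent (I : choiceType) (X : I -> {RV P >-> T}) : Prop :=
  forall (J : seq I) (B : I -> set T), uniq J -> (forall i, measurable (B i)) ->
  P (\bigcap_(i in [set` J]) X i @^-1` B i) =
  (\prod_(i <- J) P (X i @^-1` B i))%E.

Definition mexpect p q (Y : Omega -> 'M[R]_(p, q)) : 'M[R]_(p, q) :=
  \matrix_(i, j) fine 'E_P[fun w => Y w i j].

End independence.


Section vec.
Variables (R : realType) (d : nat).

(* Column stacking, in the index convention of [tensmx]. *)
Definition vec (S : 'M[R]_d) : 'cV[R]_(d * d) :=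
  \col_r S (mxtens_unindex r).2 (mxtens_unindex r).1.

Definition vech_dim : nat := (d * d.+1)./2.

(* Positions on and below the diagonal, column by column. *)
Definition vech_pairs : seq ('I_d * 'I_d) :=
  [seq (i, j) | j : 'I_d <- enum 'I_d,
                i : 'I_d <- [seq i : 'I_d <- enum 'I_d | (j <= i)%N]].

(* The index in [vech S] of the common value of [S i j] and [S j i]. *)
Definition vech_pos (i j : 'I_d) : nat :=
  index (if (j <= i)%N then (i, j) else (j, i)) vech_pairs.

Definition vech (S : 'M[R]_d) : 'cV[R]_vech_dim :=
  \col_k nth 0 [seq S ij.1 ij.2 | ij <- vech_pairs] k.

Definition dup_mx : 'M[R]_(d * d, vech_dim) :=
  \matrix_(r, k) (vech_pos (mxtens_unindex r).2 (mxtens_unindex r).1 == k)%:R.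

Definition vech' (S : 'M[R]_d) : 'cV[R]_vech_dim.-1 :=
  rowsub (widen_ord (leq_pred _)) (vech S).

(* The symmetric matrix with last diagonal entry 0 and given [vech']. *)
Definition unvech' (v : 'cV[R]_vech_dim.-1) : 'M[R]_d :=
  \matrix_(i, j) nth 0 [seq v k ord0 | k <- enum 'I_vech_dim.-1] (vech_pos i j).

End vec.
Arguments dup_mx {R d}.

Section vec_theory.
Variables (R : realType) (d : nat).
Implicit Types S : 'M[R]_d.

Let count_leq_iota m n : count (leq m) (iota 0 n) = (n - m)%N.
Proof.
elim: n => [|n IH]; first by rewrite sub0n.
rewrite -[in iota _ _]addn1 iotaD count_cat IH /= add0n.
case: leqP => [mn|nm]; first by rewrite subSn// addn1.
by move/ltnW: (nm); rewrite -!subn_eq0 => /eqP ->; apply/esym/eqP; rewrite subn_eq0.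
Qed.

Lemma size_vech_pairs : size (vech_pairs d) = vech_dim d.
Proof.
rewrite /vech_pairs size_allpairs_dep sumnE big_map big_enum /=.
rewrite (reindex_inj rev_ord_inj) /=.
rewrite (eq_bigr (fun j : 'I_d => j.+1)) => [|j _]; last first.
  rewrite size_filter -(count_map val (leq (d - j.+1))) val_enum_ord.
  by rewrite count_leq_iota subKn.
rewrite /vech_dim mulnC -[d in (_ * d)%N]/(d.+1.-1) -bin2 -bin2_sum.
by rewrite big_nat_recl// add0n big_mkord.
Qed.

Lemma vech_pairs_uniq : uniq (vech_pairs d).
Proof.
apply: allpairs_uniq_dep => [|j _|[i j] [k l] _ _ []/= -> ->//].
  exact: enum_uniq.
by rewrite filter_uniq// enum_uniq.
Qed.

Lemma mem_vech_pairs (i j : 'I_d) : ((i, j) \in vech_pairs d) = (j <= i)%N.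
Proof.
apply/allpairsPdep/idP => [[l [k [_]]]|ji].
  by rewrite mem_filter => /andP[lk _] [-> ->].
by exists j, i; split; rewrite ?mem_enum// mem_filter mem_enum andbT.
Qed.

Lemma vech_pos_lt (i j : 'I_d) : (vech_pos i j < vech_dim d)%N.
Proof.
rewrite -size_vech_pairs index_mem; case: leqP => [|/ltnW] ij;
  by rewrite mem_vech_pairs.
Qed.

Lemma vech_posC (i j : 'I_d) : vech_pos i j = vech_pos j i.
Proof.
rewrite /vech_pos; case: ltngtP => // ij.
by rewrite (val_inj ij).
Qed.

Lemma vech_pos_diag (i : 'I_d) : i.+1 = d -> vech_pos i i = (vech_dim d).-1.
Proof.
move=> id; rewrite /vech_pos leqnn -size_vech_pairs.
have li : (i, i) = last (i, i) (vech_pairs d).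
  case: d i id => // n i [ni]; have -> : i = ord_max by exact: val_inj.
  rewrite /vech_pairs enum_ordSr map_rcons flatten_rcons filter_rcons leqnn.
  by rewrite map_rcons last_cat last_rcons.
have := mem_vech_pairs i i; have := vech_pairs_uniq; move: li.
case: (vech_pairs d) => [|p s] li u; first by rewrite leqnn.
by move=> _; rewrite (li : _ = last p s) index_last.
Qed.

Lemma vech_vech_pos S (i j : 'I_d) (k : 'I_(vech_dim d)) : S^T = S ->
  vech_pos i j = k -> vech S k ord0 = S i j.
Proof.
move=> St pk; rewrite mxE -pk (nth_map (i, j)) ?nth_index; last first.
- by rewrite size_vech_pairs vech_pos_lt.
- by case: leqP => [|/ltnW] ij; rewrite mem_vech_pairs.
by case: leqP => // _ /=; rewrite -[in LHS]St mxE.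
Qed.

Lemma dup_mx_vech S : S^T = S -> dup_mx *m vech S = vec S.
Proof.
move=> St; apply/matrixP => r c; rewrite [c]ord1 !mxE.
set i := _.2; set j := _.1.
rewrite (bigD1 (Ordinal (vech_pos_lt i j)))//= mxE -/i -/j eqxx mul1r.
rewrite big1 ?addr0 => [|k]; first exact: vech_vech_pos.
by rewrite -val_eqE /= mxE eq_sym => /negbTE ->; rewrite mul0r.
Qed.

Lemma unvech'_tr (v : 'cV[R]_(vech_dim d).-1) : (unvech' v)^T = unvech' v.
Proof. by apply/matrixP => i j; rewrite !mxE vech_posC. Qed.

Lemma unvech'_last (v : 'cV[R]_(vech_dim d).-1) (i : 'I_d) :
  i.+1 = d -> unvech' v i i = 0.
Proof.
move=> id; rewrite mxE vech_pos_diag// nth_default//.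
by rewrite size_map size_enum_ord.
Qed.

Lemma vech'_unvech' (v : 'cV[R]_(vech_dim d).-1) : vech' (unvech' v) = v.
Proof.
apply/matrixP => k c; rewrite [c]ord1 !mxE /=.
have kd : (k < size (vech_pairs d))%N.
  by rewrite size_vech_pairs (leq_trans (ltn_ord k)) ?leq_pred.
case Ep : (vech_pairs d) => [|p s]; first by rewrite Ep in kd.
rewrite -Ep (nth_map p)// mxE.
have := mem_nth p kd; case En : (nth p _ k) => [i j] /=.
rewrite mem_vech_pairs /vech_pos => -> /=.
rewrite -En index_uniq ?vech_pairs_uniq// (nth_map k) ?size_enum_ord//.
by rewrite nth_ord_enum.
Qed.

End vec_theory.

Definition droplast_col (R : realType) p q (M : 'M[R]_(p, q)) : 'M[R]_(p, q.-1) :=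
  colsub (widen_ord (leq_pred q)) M.


Section derivatives.
Variables (R : realType) (d : nat).

Definition partial (j : 'I_d) (g : 'cV[R]_d -> R) : 'cV[R]_d -> R :=
  fun x => 'D_(delta_mx j ord0) g x.

Definition hessian (g : 'cV[R]_d -> R) (x : 'cV[R]_d) : 'M[R]_d :=
  \matrix_(i, j) partial i (partial j g) x.

Fixpoint Ck_on (k : nat) (U : set 'cV[R]_d) (g : 'cV[R]_d -> R) : Prop :=
  (forall x, U x -> {for x, continuous g}) /\
  if k is k'.+1 then
    forall j, (forall x, U x -> derivable g x (delta_mx j ord0)) /\
              Ck_on k' U (partial j g)
  else True.

Definition smooth_on (U : set 'cV[R]_d) (g : 'cV[R]_d -> R) : Prop :=
  forall k, Ck_on k U g.

Variable m : nat.
Implicit Type F : 'cV[R]_d -> 'cV[R]_m.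

(* [F] is smooth on a neighbourhood of the sphere and extends the restriction
   of [f] to the sphere; values of [f] off the sphere are irrelevant. *)
Definition smooth_extension (f : 'cV[R]_d -> 'cV[R]_m) F : Prop :=
  exists U : set 'cV[R]_d,
    [/\ open U, sphere `<=` U, (forall x, sphere x -> F x = f x)
      & forall i : 'I_m, smooth_on U (fun y => F y i ord0)].

Definition grad F (x : 'cV[R]_d) : 'M[R]_(m, d) :=
  \matrix_(i, j) partial j (fun y => F y i ord0) x.

Definition grad2 F (x : 'cV[R]_d) : 'M[R]_(m, d * d) :=
  \matrix_(i, r) vec (hessian (fun y => F y i ord0) x) r ord0.

Definition laplacian F (x : 'cV[R]_d) : 'cV[R]_m :=
  \col_i \sum_j partial j (partial j (fun y => F y i ord0)) x.

End derivatives.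


Definition sample_mean (R : realType) d p q
    (g : 'cV[R]_d -> 'M[R]_(p, q)) (n : nat) (x : nat -> 'cV[R]_d) : 'M[R]_(p, q) :=
  n%:R^-1 *: \sum_(i < n) g (x i).

Section sample_quantities.
Variables (R : realType) (d m : nat) (F : 'cV[R]_d -> 'cV[R]_m).
Variables (n : nat) (x : nat -> 'cV[R]_d).

Definition tangent_grad (y : 'cV[R]_d) : 'M[R]_(m, d) :=
  grad F y *m (1%:M - y *m y^T).

(* [M_n] for [F = f_2] and [G_n] for [F = f_1]; the Kronecker product has
   [m * 1] rows, whence the cast. *)
Definition stein_quad : 'M[R]_(m, vech_dim d) :=
  2 *: sample_mean (fun y =>
    castmx (muln1 m, erefl) (tangent_grad y *t y^T) *m dup_mx) n x.

(* [D_n] for [F = f_2] and [H_n] for [F = f_1] *)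
Definition stein_const : 'cV[R]_m :=
  sample_mean (fun y => (d%:R - 1) *: (grad F y *m y)
    + grad2 F y *m (y *t y : 'cV_(d * d)) - laplacian F y) n x.

(* [E_n] for [F = f_2] and [L_n] for [F = f_1] *)
Definition stein_lin : 'M[R]_(m, d) := sample_mean tangent_grad n x.

(* [M_n'] for [F = f_2] and [G_n'] for [F = f_1] *)
Definition stein_quad' : 'M[R]_(m, (vech_dim d).-1) := droplast_col stein_quad.

End sample_quantities.

Section stein_estimator.
Variables (R : realType) (d : nat).
Variables (F1 : 'cV[R]_d -> 'cV[R]_d) (F2 : 'cV[R]_d -> 'cV[R]_(vech_dim d).-1).
Variables (n : nat) (x : nat -> 'cV[R]_d).

Let M' := stein_quad' F2 n x.
Let D := stein_const F2 n x.
Let E := stein_lin F2 n x.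
Let G' := stein_quad' F1 n x.
Let H := stein_const F1 n x.
Let L := stein_lin F1 n x.

Definition stein_exists : bool :=
  (M' \in unitmx) && (L - G' *m invmx M' *m E \in unitmx).

Definition stein_mu : 'cV[R]_d :=
  invmx (L - G' *m invmx M' *m E) *m (H - G' *m invmx M' *m D).

Definition stein_A : 'M[R]_d := unvech' (invmx M' *m (D - E *m stein_mu)).

End stein_estimator.

(* Main.v *)
(** For a [C^1] function [g] near the sphere, the rotation field
    [L_ij g = x_i d_j g - x_j d_i g] has zero integral over the sphere, because
    the surface measure is rotation invariant and [L_ij g] is the derivative
    of [g] along plane rotations. Taking [x_i * h] for [g] and summing over [i]
    gives [\int (d_j h - x_j <x, grad h> - (d - 1) x_j h) = 0]; taking
    [h = p * d_j f], with [p] the Fisher-Bingham kernel, and summing over [j]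
    gives the Stein identity, which says that the expectations satisfy the
    linear system [E D = E E mu0 + E M' vech' A0], [E H = E L mu0 + E G' vech' A0].
    By the strong law of large numbers the estimator solves a system whose
    coefficients converge almost surely to these; its matrices are
    invertible, hence so are the empirical ones eventually, and the
    solutions converge. *)

From HB Require Import structures.
Require Import Defs.
From mathcomp Require Import all_boot all_order all_algebra.
From mathcomp Require Import all_classical all_reals all_analysis measurable_realfun.
From mathcomp Require Import ring lra.
From mathcomp.real_closed Require Import mxtens.
Set Implicit Arguments.
Unset Strict Implicit.
Unset Printing Implicit Defensive.
Import Order.TTheory GRing.Theory Num.Theory.
Import numFieldTopology.Exports numFieldNormedType.Exports.
Local Open Scope classical_set_scope.
Local Open Scope ring_scope.

(** Rotation invariance comes from the way the measure is built. The surface measure is the volume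
    of cones, and volume on columns is assembled one coordinate at a time, so Fubini and translation
    invariance on the line give invariance under shears. A plane rotation other than the half-turn
    is a product of three shears. Small angles suffice, because only the derivative at angle 0 is
    wanted. The Stein identity is linear in the parameters because the score [mu + 2 A y] of the
    kernel is. The normalizing constant only multiplies an integral that vanishes, so its value
    never enters. Smoothness is given by iterated partial derivatives; the chain rule along
    rotations therefore needs Fréchet differentiability, obtained from continuity of the partials.
    All functions involved are continuous near the compact sphere, hence bounded on it. This yields
    integrability, dominated convergence, and a strong law from second moments alone. Values off the
    sphere are uncontrolled, so functions are cut off to 0 there whenever an argument runs over the
    whole space. *)

Section finite_sums_and_products.
Variables (T I : Type) (F : set_system T) (K : numFieldType).
Context {FF : Filter F}.

Lemma cvg_bigsum (V : normedModType K) (r : seq I) (P : pred I)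
    (f : I -> T -> V) (l : I -> V) :
  (forall i, P i -> f i x @[x --> F] --> l i) ->
  \sum_(i <- r | P i) f i x @[x --> F] --> \sum_(i <- r | P i) l i.
Proof.
move=> fl; elim: r => [|i r IH].
  by rewrite big_nil; under eq_fun do rewrite big_nil; exact: cvg_cst.
rewrite big_cons; under eq_fun do rewrite big_cons.
by case: ifPn => // Pi; apply: cvgD => //; exact: fl.
Qed.

Lemma cvg_bigprod (r : seq I) (P : pred I) (f : I -> T -> K) (l : I -> K) :
  (forall i, P i -> f i x @[x --> F] --> l i) ->
  \prod_(i <- r | P i) f i x @[x --> F] --> \prod_(i <- r | P i) l i.
Proof.
move=> fl; elim: r => [|i r IH].
  by rewrite big_nil; under eq_fun do rewrite big_nil; exact: cvg_cst.
rewrite big_cons; under eq_fun do rewrite big_cons.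
by case: ifPn => // Pi; apply: cvgM => //; exact: fl.
Qed.

End finite_sums_and_products.

(** * Measurability, compactness and boundedness for columns and the sphere *)

Section column_vectors.
Variables (R : realType) (d : nat).
Implicit Types (U : set 'cV[R]_d) (g : 'cV[R]_d -> R) (x : 'cV[R]_d).

(** Links the sup-norm topology with the sigma-algebra generated by the coordinates: an open set is
    the union of the countably many boxes with rational centre and radius that it contains. *)
Lemma open_measurable_cV U : open U -> measurable U.
Proof.
move=> oU.
pose box (p : 'cV[rat]_d * rat) : set 'cV[R]_d := [set x | forall i,
  x i ord0 \in `]ratr (p.1 i ord0) - ratr p.2, ratr (p.1 i ord0) + ratr p.2[].
pose F p := if pselect (box p `<=` U) then box p else set0.
have -> : U = \bigcup_p F p.
  apply/seteqP; split => [x Ux|x [p _]]; last first.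
    by rewrite /F; case: pselect => // pU /pU.
  have /nbhs_ballP[e /= e0 eU] : nbhs x U by rewrite nbhsE; exists U.
  (* A radius below [e / 2] and a centre within that radius of [x] keep the whole box within [e] of
     [x]. *)
  have [r] := rat_in_itvoo (divr_gt0 e0 (ltr0n R 2) : 0 < e / 2).
  rewrite in_itv /= => /andP[r0 re].
  have qP i : exists q : rat, (ratr q : R) \in `]x i ord0 - ratr r, x i ord0 + ratr r[.
    by apply: rat_in_itvoo; lra.
  pose q : 'cV[rat]_d := \col_i projT1 (cid (qP i)).
  have qE i : x i ord0 - ratr r < ratr (q i ord0) < x i ord0 + ratr r.
    by rewrite mxE; case: cid => /= y; rewrite in_itv.
  exists (q, r) => //; rewrite /F; case: pselect => [bU /=|[]].
    by move=> i; have /andP[? ?] := qE i; rewrite in_itv /=; apply/andP; split; lra.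
  move=> y qy; apply: eU; split => // i j.
  rewrite [j]ord1 /ball /=; move: (qE i) (qy i).
  by rewrite in_itv /= ltr_norml => /andP[? ?] /andP[? ?]; apply/andP; split; lra.
apply: countable_bigcupT_measurable => [|p]; first exact: countableP.
rewrite /F; case: pselect => /= [_|_] //.
rewrite [X in measurable X](_ : _ = \bigcap_(i in [set: 'I_d])
    ((fun x : 'cV[R]_d => x i ord0) @^-1`
      `]ratr (p.1 i ord0) - ratr p.2, ratr (p.1 i ord0) + ratr p.2[%classic)).
  apply: fin_bigcap_measurable => // i _.
  rewrite -[X in measurable X]setTI; apply: measurable_cV_coord => //.
by apply/seteqP; split => x xp i => [_|]; [exact: (xp i)|exact: (xp i I)].
Qed.

Lemma open_continuous_measurable_cV U g :
  open U -> (forall x, U x -> {for x, continuous g}) -> measurable_fun U g.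
Proof.
move=> oU cg; apply: (measurability _ (RGenOpens.measurableE R)).
move=> _ [_ [a [b ->] <-]]; apply: open_measurable_cV.
rewrite openE => x [Ux gx]; apply: filterI.
  by rewrite nbhsE; exists U.
by apply: cg => //; rewrite nbhsE /=; exists `]a, b[%classic => //; split => //; exact: interval_open.
Qed.

Lemma sphereP x : sphere x <-> \sum_i x i ord0 ^+ 2 = 1.
Proof.
have -> : \sum_i x i ord0 ^+ 2 = (x^T *m x) ord0 ord0.
  by rewrite mxE; apply: eq_bigr => i _; rewrite mxE expr2.
split=> [->|xx]; first by rewrite mxE.
by apply/matrixP => i j; rewrite !ord1 xx mxE.
Qed.


Lemma continuous_sum_sqr : continuous (fun x : 'cV[R]_d => \sum_i x i ord0 ^+ 2).
Proof.
move=> x; apply: (@cvg_bigsum _ _ (nbhs x)) => i _.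
by apply: (@continuous_comp _ _ _ (fun x : 'cV[R]_d => x i ord0) (fun r => r ^+ 2));
  [exact: coord_continuous|exact: exprn_continuous].
Qed.

Lemma closed_sphere : closed (sphere : set 'cV[R]_d).
Proof.
rewrite (_ : sphere = (fun x : 'cV[R]_d => \sum_i x i ord0 ^+ 2) @^-1` [set 1]).
  apply: preimage_closed; first by move=> x _; exact: continuous_sum_sqr.
  exact: closed_eq.
by apply/seteqP; split => x /= /sphereP.
Qed.

Lemma measurable_sphere : measurable (sphere : set 'cV[R]_d).
Proof.
rewrite -[sphere]setCK; apply: measurableC; apply: open_measurable_cV.
by apply: closed_openC; exact: closed_sphere.
Qed.

Lemma sphere_coord_le1 x i : sphere x -> `|x i ord0| <= 1.
Proof.
move=> /sphereP; rewrite (bigD1 i) //= => xx.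
have : x i ord0 ^+ 2 <= 1 by rewrite -xx lerDl sumr_ge0// => j _; exact: sqr_ge0.
by rewrite -real_normK ?num_real// expr_le1.
Qed.

Lemma compact_sphere : compact (sphere : set 'cV[R]_d).
Proof.
(* The cube is compact as a set of rows; transposition carries it to columns, where it contains the
   closed set [sphere]. *)
have K : compact [set v : 'rV[R]_d | forall i, `[(-1), 1]%classic (v ord0 i)].
  exact: (@rV_compact R d (fun=> `[(-1), 1]%classic) (fun=> @segment_compact R _ _)).
have tr_cts : continuous (trmx : 'rV[R]_d -> 'cV[R]_d).
  move=> x A [P Px PA]; exists (fun i j => P j i) => [i j|y yP].
    by have := Px j i; rewrite mxE.
  by apply: PA => i j; rewrite mxE; exact: yP.
have /(subclosed_compact closed_sphere) := continuous_compact
  (continuous_subspaceT tr_cts) K.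
apply=> x Sx; exists x^T; last by rewrite trmxK.
by move=> i /=; rewrite mxE in_itv/= -ler_norml; exact: sphere_coord_le1.
Qed.

(** Source of the bounds behind integrability, domination and the strong law: test functions, their
    derivatives and the kernel are continuous near the sphere. *)
Lemma continuous_sphere_bounded g :
  (forall x, sphere x -> {for x, continuous g}) ->
  exists M, forall x, sphere x -> `|g x| <= M.
Proof.
move=> cg; have : compact (g @` sphere).
  apply: continuous_compact compact_sphere; apply: continuous_in_subspaceT.
  by move=> x /set_mem; exact: cg.
move=> /compact_bounded[M [_ MP]]; exists (M + 1) => x Sx.
by apply: (MP (M + 1)); [rewrite ltrDl|exists x].
Qed.

End column_vectors.

(** * Rotation invariance of the surface measure *)

Lemma lebesgue_measure_translation (R : realType) (c : R) (A : set R) :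
  measurable A -> lebesgue_measure ((fun x => x + c) @^-1` A) = lebesgue_measure A.
Proof.
move=> mA.
have mc : measurable_fun [set: measurableTypeR R]
    ((fun x => x + c) : measurableTypeR R -> measurableTypeR R).
  exact: measurable_funD.
pose m' := measure_function_pushforward__canonical__measure_function_Measure
  (@lebesgue_measure R) mc.
apply/esym/(@lebesgue_measure_unique _ m') => //= _ [[a b]] _ <- /=.
rewrite /pushforward [X in _ = lebesgue_measure X](_ : _ = `]a - c, b - c]%classic).
  by rewrite !lebesgue_measure_itv/= !lte_fin ltrD2r -!EFinB; congr (if _ then _%:E else _); ring.
by apply/seteqP; split => x /=; rewrite !in_itv /= ltrBlDr lerBrDr.
Qed.

Section shear.
Variable R : realType.

Lemma shear_coord n (x : 'cV[R]_n) (c : R) (i k : 'I_n) :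
  (x + c *: delta_mx i ord0) k ord0 = x k ord0 + c * (k == i)%:R.
Proof. by rewrite !mxE andbT. Qed.

Lemma measurable_cV_shear n (i : 'I_n) (phi : 'cV[R]_n -> R) :
  measurable_fun setT phi ->
  measurable_fun setT (fun x : 'cV[R]_n => x + phi x *: delta_mx i ord0).
Proof.
move=> mphi; apply/measurable_fun_cVP => k.
rewrite [X in measurable_fun _ X](_ : _ =
  (fun x : 'cV[R]_n => x k ord0 + phi x * (k == i)%:R)).
  by apply: measurable_funD; [exact: measurable_cV_coord|exact: measurable_funM].
by apply/funext => x; rewrite shear_coord.
Qed.

Lemma cV_cons_rec n (a : R) (v : 'cV[R]_n) :
  (cV_cons (a, v) ord0 ord0 = a) *
  (forall j, cV_cons (a, v) (lift ord0 j) ord0 = v j ord0).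
Proof.
split=> [|j]; rewrite /cV_cons /= mxE; case: splitP => k.
- by rewrite ord1 mxE eqxx mulr1n.
- by [].
- by rewrite ord1.
- by rewrite /= /bump /= !add1n => -[/val_inj ->].
Qed.

(* For i = 0, Fubini reduces this to translation invariance in the first
   coordinate; otherwise it is the induction hypothesis on the slices. *)
Lemma lebesgue_cV_shear n (i : 'I_n) (phi : 'cV[R]_n -> R) (B : set 'cV[R]_n) :
  measurable_fun setT phi ->
  (forall x a, phi (x + a *: delta_mx i ord0) = phi x) ->
  measurable B ->
  lebesgue_cV R n ((fun x => x + phi x *: delta_mx i ord0) @^-1` B) =
  lebesgue_cV R n B.
Proof.
elim: n i phi B => [[]//|n IH] i phi B mphi phii mB.
have mC : measurable (@cV_cons R n @^-1` B).
  by rewrite -[X in measurable X]setTI; exact: measurable_cV_cons.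
have mC' : measurable (@cV_cons R n @^-1`
    ((fun x => x + phi x *: delta_mx i ord0) @^-1` B)).
  rewrite -[X in measurable X]setTI; apply: measurable_cV_cons => //.
  by rewrite -[X in measurable X]setTI; exact: measurable_cV_shear.
rewrite /= /cons_measure /pushforward.
have [i0|[j ij]] : i = ord0 \/ exists j, i = lift ord0 j.
  by case: (unliftP ord0 i) => [j ->|->]; [right; exists j|left].
- pose m' : {measure set (measurableTypeR R * 'cV[R]_n) -> \bar R} :=
    (@lebesgue_measure R \x^ lebesgue_cV R n)%E.
  (* By uniqueness of the product measure the first coordinate may be integrated innermost. There
     the shear is translation by the constant [c], because [phi] ignores that coordinate. *)
  have sw := product_measure_unique (m' := m')
    (product_measure2E (@lebesgue_measure R) (lebesgue_cV R n)).
  rewrite !sw//= /product_measure2; apply: eq_integral => v _ /=.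
  pose c := phi (cV_cons (0, v)).
  have consE a : cV_cons (a, v) = cV_cons (0, v) + a *: delta_mx i ord0.
    apply/matrixP => k l; rewrite [l]ord1 i0 shear_coord.
    case: (unliftP ord0 k) => [j ->|->]; rewrite !cV_cons_rec.
      by rewrite mulr0 addr0.
    by rewrite eqxx mulr1 add0r.
  rewrite -[RHS](lebesgue_measure_translation c); last exact: measurable_ysection.
  have shE a : cV_cons (a, v) + phi (cV_cons (a, v)) *: delta_mx i ord0 =
      cV_cons (a + c, v).
    by rewrite [in RHS]consE (consE a) phii -/c scalerDl addrA.
  congr (lebesgue_measure _); apply/seteqP; split => a; rewrite /ysection/= !inE.
    by rewrite /preimage /= shE.
  by rewrite /preimage /= shE.
- rewrite /product_measure1; apply: eq_integral => a _ /=.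
  have mcons : measurable_fun setT (fun v : 'cV[R]_n => cV_cons (a, v)).
    apply: measurableT_comp; first exact: measurable_cV_cons.
    exact: measurable_pair1.
  have consD v t : cV_cons (a, v + t *: delta_mx j ord0) =
      cV_cons (a, v) + t *: delta_mx i ord0.
    apply/matrixP => k l; rewrite [l]ord1 ij shear_coord.
    case: (unliftP ord0 k) => [k' ->|->]; rewrite !cV_cons_rec.
      by rewrite shear_coord (inj_eq lift_inj).
    by rewrite mulr0 addr0.
  rewrite -[RHS](IH j (fun v => phi (cV_cons (a, v)))).
  + congr (lebesgue_cV R n _); apply/seteqP; split => v;
    by rewrite /xsection/= !inE /preimage /= consD.
  + exact: measurableT_comp mphi mcons.
  + by move=> v t; rewrite consD phii.
  + exact: measurable_xsection.
Qed.

End shear.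

Section plane_rotations.
Variables (R : realType) (d : nat).
Implicit Types (i j k : 'I_d) (x : 'cV[R]_d) (B : set 'cV[R]_d) (c s : R).

(** For [c = cos t] and [s = sin t], the rotation by [t] in the plane of coordinates [i] and [j].
    Writing it as [x] plus increments makes its entries instances of [shear_coord]; leaving [c] and
    [s] free reduces the identities to algebra with [c ^+ 2 + s ^+ 2 = 1]. *)
Definition plane_rotation i j c s x : 'cV[R]_d :=
  x + ((c - 1) * x i ord0 - s * x j ord0) *: delta_mx i ord0
    + (s * x i ord0 + (c - 1) * x j ord0) *: delta_mx j ord0.

Lemma plane_rotation_coord i j c s x k : i != j ->
  plane_rotation i j c s x k ord0 =
  if k == i then c * x i ord0 - s * x j ord0
  else if k == j then s * x i ord0 + c * x j ord0 else x k ord0.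
Proof.
move=> ij; rewrite /plane_rotation !shear_coord.
case: eqVneq => [->|ki]; first by rewrite (negbTE ij) /=; ring.
by case: eqVneq => [->|kj] /=; ring.
Qed.

Let shear i j (a : R) x := x + (a * x j ord0) *: delta_mx i ord0.

Let measurable_shear i j a : measurable_fun setT (shear i j a).
Proof.
by apply: measurable_cV_shear; apply: measurable_funM => //; exact: measurable_cV_coord.
Qed.

Let lebesgue_shear i j a B : i != j -> measurable B ->
  lebesgue_cV R d (shear i j a @^-1` B) = lebesgue_cV R d B.
Proof.
move=> ij mB; apply: (@lebesgue_cV_shear _ _ i (fun x => a * x j ord0)) => //.
  by apply: measurable_funM => //; exact: measurable_cV_coord.
by move=> x b; rewrite shear_coord eq_sym (negbTE ij) mulr0 addr0.
Qed.

(* With t the angle, a = s / (1 + c) = tan (t / 2). *)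
Let plane_rotationE i j c s : i != j -> c ^+ 2 + s ^+ 2 = 1 -> 1 + c != 0 ->
  plane_rotation i j c s =
  shear i j (- (s / (1 + c))) \o shear j i s \o shear i j (- (s / (1 + c))).
Proof.
move=> ij cs c0; apply/funext => x; apply/matrixP => k l; rewrite [l]ord1 /=.
rewrite plane_rotation_coord// /shear !shear_coord !eqxx.
have s2 : s ^+ 2 = 1 - c ^+ 2 by rewrite -cs; ring.
have -> : (j == i) = false by rewrite eq_sym (negbTE ij).
case: eqVneq => [->|ki] /=; first by rewrite (negbTE ij) !mulr1 !mulr0 !addr0; field: s2.
case: eqVneq => [->|kj] /=; last by rewrite !mulr0 !addr0.
by rewrite !mulr0 !mulr1 !addr0; field: s2.
Qed.

Lemma measurable_plane_rotation i j c s :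
  measurable_fun setT (plane_rotation i j c s).
Proof.
apply/measurable_fun_cVP => k.
rewrite (_ : (fun _ => _) = (fun x : 'cV[R]_d => x k ord0
    + ((c - 1) * x i ord0 - s * x j ord0) * (k == i)%:R
    + (s * x i ord0 + (c - 1) * x j ord0) * (k == j)%:R)).
  apply: measurable_funD.
    apply: measurable_funD; first exact: measurable_cV_coord.
    by apply: measurable_funM => //; apply: measurable_funB;
      apply: measurable_funM => //; exact: measurable_cV_coord.
  by apply: measurable_funM => //; apply: measurable_funD;
      apply: measurable_funM => //; exact: measurable_cV_coord.
by apply/funext => x; rewrite /plane_rotation !shear_coord.
Qed.

Lemma lebesgue_cV_rotation i j c s B :
  i != j -> c ^+ 2 + s ^+ 2 = 1 -> 1 + c != 0 -> measurable B ->
  lebesgue_cV R d (plane_rotation i j c s @^-1` B) = lebesgue_cV R d B.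
Proof.
move=> ij cs c0 mB; rewrite plane_rotationE//.
have mp k l a C : measurable C -> measurable (shear k l a @^-1` C).
  by move=> mC; rewrite -[X in measurable X]setTI; exact: measurable_shear.
set a := - _; have mB1 := mp i j a B mB; have mB2 := mp j i s _ mB1.
have ji : j != i by rewrite eq_sym.
exact: etrans (lebesgue_shear a ij mB2)
  (etrans (lebesgue_shear s ji mB1) (lebesgue_shear a ij mB)).
Qed.

Lemma sum_sqr_rotation i j c s x : i != j -> c ^+ 2 + s ^+ 2 = 1 ->
  \sum_k plane_rotation i j c s x k ord0 ^+ 2 = \sum_k x k ord0 ^+ 2.
Proof.
move=> ij cs; have ji : j != i by rewrite eq_sym.
rewrite (bigD1 i)// (bigD1 j)//= [RHS](bigD1 i)// [in RHS](bigD1 j)//=.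
rewrite !plane_rotation_coord// !eqxx (negbTE ji) !addrA; congr (_ + _).
  have -> : x i ord0 ^+ 2 + x j ord0 ^+ 2 =
    (c ^+ 2 + s ^+ 2) * (x i ord0 ^+ 2 + x j ord0 ^+ 2) by rewrite cs mul1r.
  by ring.
apply: eq_bigr => k /andP[ki kj].
by rewrite plane_rotation_coord// (negbTE ki) (negbTE kj).
Qed.

Lemma sphere_rotation i j c s x : i != j -> c ^+ 2 + s ^+ 2 = 1 ->
  sphere (plane_rotation i j c s x) <-> sphere x.
Proof. by move=> ij cs; rewrite !sphereP sum_sqr_rotation. Qed.

Lemma plane_rotationZ i j c s a x :
  plane_rotation i j c s (a *: x) = a *: plane_rotation i j c s x.
Proof. by apply/matrixP => k l; rewrite !mxE; ring. Qed.

End plane_rotations.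

Section surface.
Variables (R : realType) (d : nat).
Implicit Types (x : 'cV[R]_d) (B : set 'cV[R]_d).

Let sqn x := \sum_i x i ord0 ^+ 2.

Lemma sum_sqrZ (r : R) x :
  \sum_i (r *: x) i ord0 ^+ 2 = r ^+ 2 * \sum_i x i ord0 ^+ 2.
Proof. by rewrite mulr_sumr; apply: eq_bigr => i _; rewrite mxE exprMn. Qed.

Lemma coneP B x : cone B x <->
  0 < \sum_i x i ord0 ^+ 2 <= 1 /\ B ((Num.sqrt (\sum_i x i ord0 ^+ 2))^-1 *: x).
Proof.
split=> [[r [y [/andP[r0 r1] /sphereP y1 By ->]]]|[/andP[x0 x1] Bx]].
  rewrite sum_sqrZ y1 mulr1 sqrtr_sqr gtr0_norm// scalerA mulVf ?gt_eqF//.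
  by rewrite scale1r exprn_gt0//= expr_le1 // ltW.
have s0 : 0 < Num.sqrt (\sum_i x i ord0 ^+ 2) by rewrite sqrtr_gt0.
eexists; eexists; split; [|..|exact: Bx|].
- by apply/andP; split; [exact: s0|rewrite -sqrtr1 ler_wsqrtr].
- apply/sphereP; rewrite sum_sqrZ exprVn sqr_sqrtr ?mulVf ?gt_eqF//.
  exact: ltW.
- by rewrite scalerA divff ?scale1r ?gt_eqF.
Qed.

Lemma measurable_cone B : measurable B -> measurable (cone B).
Proof.
move=> mB.
have msqn : measurable_fun [set: 'cV[R]_d] sqn.
  by apply: measurable_sum => i; apply: measurable_funX; exact: measurable_cV_coord.
rewrite (_ : cone B = (sqn @^-1` `]0, 1]%classic) `&`
    ((fun x => (Num.sqrt (sqn x))^-1 *: x) @^-1` B)); last first.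
  by apply/seteqP; split => x /=; rewrite in_itv => /coneP.
apply: measurableI; rewrite -[X in measurable X]setTI; first exact: msqn.
suff : measurable_fun setT (fun x => (Num.sqrt (sqn x))^-1 *: x) by exact.
apply/measurable_fun_cVP => i.
(* The inverse square root becomes a real power, known to be measurable; at 0 both take the value 0
   by convention. *)
rewrite [X in measurable_fun _ X](_ : _ =
  (fun x => (sqn x) `^ (- 2^-1) * x i ord0)).
  apply: measurable_funM; last exact: measurable_cV_coord.
  exact: (measurableT_comp (measurable_powR (- 2^-1)) msqn).
by apply/funext => x; rewrite mxE powRN powR12_sqrt// sumr_ge0// => k _; rewrite sqr_ge0.
Qed.

(** Rotations preserve the norm and commute with scaling, so the preimage of the cone over [B] is
    the cone over the preimage of [B], and invariance of volume carries over. *)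
Lemma surface_measure_rotation (i j : 'I_d) (c s : R) B :
  i != j -> c ^+ 2 + s ^+ 2 = 1 -> 1 + c != 0 -> measurable B ->
  surface_measure (plane_rotation i j c s @^-1` B) = surface_measure B.
Proof.
move=> ij cs c0 mB; rewrite /surface_measure; congr (_ * _)%E.
rewrite -[RHS](@lebesgue_cV_rotation _ _ i j c s)//; last exact: measurable_cone.
congr (lebesgue_cV R d _); apply/seteqP; split => x; rewrite /preimage /=.
  move=> /coneP[x01 Bx]; apply/coneP; rewrite sum_sqr_rotation//; split => //.
  by rewrite -plane_rotationZ.
move=> /coneP; rewrite sum_sqr_rotation// => -[x01 Bx].
by apply/coneP; split => //=; rewrite plane_rotationZ.
Qed.

(** Every cone lies in the cube with sides [[-1, 1]], whose volume is a finite product. *)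
Lemma surface_measure_lty B : measurable B -> (surface_measure B < +oo)%E.
Proof.
move=> mB; pose box := [set x : 'cV[R]_d | forall i, `[(-1), 1]%classic (x i ord0)].
have mI : measurable box.
  rewrite (_ : box = \bigcap_(i in [set: 'I_d])
      ((fun x : 'cV[R]_d => x i ord0) @^-1` `[(-1), 1]%classic)).
    apply: fin_bigcap_measurable => // i _.
    by rewrite -[X in measurable X]setTI; exact: measurable_cV_coord.
  by apply/seteqP; split => x Ix i => [_|]; [exact: (Ix i)|exact: (Ix i I)].
have cI : cone B `<=` box.
  move=> _ [r [y [/andP[r0 r1] Sy _ ->]]] i /=.
  rewrite in_itv /= -ler_norml mxE normrM gtr0_norm// mulr_ile1 ?normr_ge0// ?(ltW r0)//.
  exact: sphere_coord_le1.
rewrite /surface_measure lte_mul_pinfty ?lee_fin//.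
apply: (@le_lt_trans _ _ (lebesgue_cV R d box)).
  by apply: le_measure; rewrite ?inE//; exact: measurable_cone.
rewrite (lebesgue_cV_box (fun=> measurable_itv `[(-1), 1])).
rewrite ltey_eq; apply/orP; left.
apply: (big_ind (fun u => u \is a fin_num)) => // [u v uf vf|i _].
  exact: fin_numM.
by rewrite /= lebesgue_measure_itv /= lte_fin; case: ifP.
Qed.


Lemma surface_integrable (g : 'cV[R]_d -> R) (M : R) :
  measurable_fun sphere g -> (forall x, sphere x -> `|g x| <= M) ->
  surface_measure.-integrable sphere (EFin \o g).
Proof.
move=> mg gM; apply: measurable_bounded_integrable => //.
- exact: measurable_sphere.
- by apply: surface_measure_lty; exact: measurable_sphere.
- exists M; split; first exact: num_real.
  by move=> r Mr x Sx; apply: le_trans (gM _ Sx) _; exact: ltW.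
Qed.

Lemma Rintegral_surface_rotation (g : 'cV[R]_d -> R) (M : R)
    (i j : 'I_d) (c s : R) :
  i != j -> c ^+ 2 + s ^+ 2 = 1 -> 1 + c != 0 ->
  measurable_fun sphere g -> (forall x, sphere x -> `|g x| <= M) ->
  (\int[surface_measure]_(x in sphere) (g (plane_rotation i j c s x)) =
   \int[surface_measure]_(x in sphere) g x)%R.
Proof.
move=> ij cs c0 mg gM.
have mrot := measurable_plane_rotation i j c s.
(* The change of variables needs a function measurable on the whole space, while [g] is controlled
   only on the sphere. *)
pose g' := g \_ sphere.
have mg' : measurable_fun setT g'.
  by apply/(measurable_restrictT _ _).1 => //; exact: measurable_sphere.
have rotS : plane_rotation i j c s @^-1` sphere = sphere.
  by apply/seteqP; split => x; rewrite /preimage /=; move/(sphere_rotation _ ij cs).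
transitivity (\int[surface_measure]_(x in sphere) (g' (plane_rotation i j c s x)))%R.
  apply: eq_Rintegral => x /set_mem Sx; rewrite /g' patchE mem_set//.
  exact/(sphere_rotation _ ij cs).
transitivity (\int[surface_measure]_(x in sphere) g' x)%R; last first.
  by apply: eq_Rintegral => x Sx; rewrite /g' patchE Sx.
rewrite /Rintegral; congr fine.
transitivity (\int[pushforward surface_measure (plane_rotation i j c s)]_(x in sphere)
   (g' x)%:E)%E; last first.
  apply: eq_measure_integral => A mA _.
  exact: surface_measure_rotation.
rewrite integral_pushforward//=.
- by rewrite rotS.
- exact/measurable_EFinP.
- rewrite rotS; apply: (@surface_integrable (g' \o plane_rotation i j c s) M).
    by apply: measurable_funTS; exact: measurableT_comp.
  move=> x Sx /=; rewrite /g' patchE mem_set; first apply: gM.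
    exact/(sphere_rotation _ ij cs).
  exact/(sphere_rotation _ ij cs).
- exact: measurable_sphere.
Qed.

End surface.

(** * Integration by parts on the sphere *)

Lemma is_diff_near (R : realType) (V W : normedModType R) (f : V -> W)
    (df : {linear V -> W}) (x : V) : continuous df ->
  (forall e : R, 0 < e ->
     \forall h \near 0, `|f (h + x) - f x - df h| <= e * `|h|) ->
  is_diff x f df.
Proof.
move=> cdf H.
have dE : f \o shift x = cst (f x) + df +o_ 0 id.
  apply/eqaddoP => e e0; apply: filterS (H e e0) => h /=.
  by rewrite /= opprD addrA.
have dfE : 'd f x = df :> (_ -> _) by exact: diff_unique.
by split; [apply/diff_locallyP; rewrite dfE|].
Qed.

(** * Differentiability and the chain rule from continuous partial derivatives *)

Section C1.
Variables (R : realType) (d : nat).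
Implicit Types (U : set 'cV[R]_d) (g : 'cV[R]_d -> R) (x y : 'cV[R]_d).

Lemma is_derive_line g y v (t : R) :
  derivable g (y + t *: v) v ->
  is_derive t (1:R) (fun s => g (y + s *: v)) ('D_v g (y + t *: v)).
Proof.
have E : (fun h : R => h^-1 *: (g (h *: v + (y + t *: v)) - g (y + t *: v))) =
    (fun h => h^-1 *: (((fun s => g (y + s *: v)) \o shift t) (h *: 1) - g (y + t *: v))).
  apply/funext => h /=; congr (_ *: (g _ - _)).
  by rewrite [h *: 1]mulr1 scalerDl addrCA.
move=> dg; split; first by rewrite /derivable -E.
by rewrite /derive -E.
Qed.

(** By the mean value theorem the increment is [a] times a partial derivative at an intermediate
    point, which differs from [D] by at most [e]. *)
Lemma mean_value_coord g y (k : 'I_d) (D a e : R) : 0 <= e ->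
  (forall t, `|t| <= `|a| -> derivable g (y + t *: delta_mx k ord0) (delta_mx k ord0) /\
     `|partial k g (y + t *: delta_mx k ord0) - D| <= e) ->
  `|g (y + a *: delta_mx k ord0) - g y - a * D| <= e * `|a|.
Proof.
move=> e0 H; pose phi (t : R) := g (y + t *: delta_mx k ord0).
pose dphi (t : R) := partial k g (y + t *: delta_mx k ord0).
have phiP (t : R) : `|t| <= `|a| ->
    is_derive (t : R) (1 : R) phi (partial k g (y + t *: delta_mx k ord0)).
  by move=> /H[dg _]; exact: is_derive_line.
have -> : g y = phi 0 by rewrite /phi scale0r addr0.
rewrite -/(phi a).
have cphi (b c : R) : (forall t, b <= t <= c -> `|t| <= `|a|) ->
    {within `[b, c], continuous phi}.
  move=> bc; apply: derivable_within_continuous => t; rewrite in_itv /= => /bc /phiP.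
  by move=> [].
have [a0|a0|->] := ltrgt0P a; last by rewrite mul0r subrr subr0 normr0 mulr0.
- have ba t : 0 <= t <= a -> `|t| <= `|a|.
    by move=> /andP[t0 ta]; rewrite !ger0_norm// ltW.
  have [|c cab ->] := @MVT _ phi dphi 0 a a0 _ (cphi 0 a ba).
    by move=> t; rewrite in_itv /= => /andP[/ltW t0 /ltW ta]; apply: phiP; rewrite ba// t0.
  move: cab; rewrite in_itv /= => /andP[/ltW c0 /ltW ca].
  rewrite subr0 /dphi [_ * a]mulrC -mulrBr normrM gtr0_norm// mulrC ler_pM2r//.
  by apply: (H c _).2; rewrite ba// c0.
- have ba t : a <= t <= 0 -> `|t| <= `|a|.
    by move=> /andP[t0 ta]; rewrite !ler0_norm ?lerN2// ltW.
  have [|c cab] := @MVT _ phi dphi a 0 a0 _ (cphi a 0 ba).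
    by move=> t; rewrite in_itv /= => /andP[/ltW t0 /ltW ta]; apply: phiP; rewrite ba// t0.
  rewrite sub0r mulrN => E.
  have -> : phi a - phi 0 = a * partial k g (y + c *: delta_mx k ord0).
    by rewrite -opprB E opprK mulrC.
  move: cab; rewrite in_itv /= => /andP[/ltW c0 /ltW ca].
  rewrite -mulrBr normrM ltr0_norm// mulrC ler_pM2r ?oppr_gt0//.
  by apply: (H c _).2; rewrite ba// c0.
Qed.

Let dlin g x (v : 'cV[R]_d) : R := \sum_k v k ord0 * partial k g x.

Let dlin_linear g x : linear (dlin g x).
Proof.
move=> a u v; rewrite /dlin scaler_sumr -big_split /=; apply: eq_bigr => k _.
by rewrite !mxE mulrDl -mulrA.
Qed.

(** [Ck_on] speaks of partial derivatives only, whereas the chain rule needs a total differential.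
    The increment is split into moves along one coordinate at a time, each controlled by
    [mean_value_coord]. *)
Lemma C1_is_diff U g x : open U -> Ck_on 1 U g -> U x ->
  is_diff x g (fun v => \sum_k v k ord0 * partial k g x).
Proof.
move=> oU [_ C1g] Ux.
pose sc := GRing.isLinear.Build _ _ _ _ _ (@dlin_linear g x).
pose df : {linear 'cV[R]_d -> R} := HB.pack (dlin g x) sc.
have cdf : continuous df.
  move=> v; apply: (@cvg_bigsum _ _ (nbhs v)) => k _.
  by apply: cvgMr_tmp; exact: coord_continuous.
apply: (@is_diff_near _ _ _ g df x cdf) => e e0.
(* The error is shared among [d] coordinate moves; [d.+1] avoids a division by 0. *)
have e'0 : 0 < e / d.+1%:R by rewrite divr_gt0.
have /nbhs_ballP[r /= r0 rP] : nbhs x [set y | U y /\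
   forall k, `|partial k g y - partial k g x| <= e / d.+1%:R].
  apply: filterI; first by rewrite nbhsE; exists U.
  apply: (filter_forall (nbhs_filter x)) => k.
  have [_ [ck _]] := C1g k.
  have /cvgrPdist_le/(_ _ e'0) := ck x Ux.
  by apply: filterS => y; rewrite distrC.
near=> h.
have hr k : `|h k ord0| < r.
  have : ball 0 r h.
    by near: h; exact: nbhsx_ballx.
  by rewrite /ball /= => -[_] /(_ k ord0); rewrite /ball /= mxE sub0r normrN.
have hn k : `|h k ord0| <= `|h|.
  by rewrite [leRHS]/Num.Def.normr/= mx_normrE; exact: (le_bigmax _ _ (k, ord0)).
(* The path from [x] to [h + x]: at [p n] the first [n] coordinates have already moved. *)
pose p (n : nat) : 'cV[R]_d := \col_i (x i ord0 + (if (i < n)%N then h i ord0 else 0)).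
have pS (k : 'I_d) : p k.+1 = p k + h k ord0 *: delta_mx k ord0.
  apply/matrixP => i l; rewrite [l]ord1 !mxE andbT ltnS.
  case: (ltngtP i k) => ik; rewrite -val_eqE /=.
  - by rewrite (ltn_eqF ik) mulr0 addr0.
  - by rewrite (gtn_eqF ik) mulr0 !addr0.
  - by rewrite ik eqxx mulr1 addr0 (val_inj ik).
rewrite [X in `|X|](_ : _ = \sum_(k < d) (g (p k.+1) - g (p k) -
    h k ord0 * partial k g x)); last first.
  rewrite big_split /= sumrN -(big_mkord xpredT (fun k => g (p k.+1) - g (p k))).
  rewrite telescope_sumr//.
  have -> : p 0 = x by apply/matrixP => i l; rewrite [l]ord1 mxE addr0.
  have -> : p d = h + x.
    by apply/matrixP => i l; rewrite [l]ord1 !mxE ltn_ord addrC.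
  by [].
rewrite (le_trans (ler_norm_sum _ _ _))//.
rewrite (@le_trans _ _ (\sum_(k < d) e / d.+1%:R * `|h|))//; last first.
  rewrite sumr_const card_ord -[X in X <= _]mulr_natl !mulrA ler_wpM2r//.
  by rewrite ler_pdivrMr// mulrC ler_pM2l// ler_nat.
apply: ler_sum => k _; rewrite pS.
rewrite (@le_trans _ _ (e / d.+1%:R * `|h k ord0|))//; last by rewrite ler_pM2l.
apply: (mean_value_coord (ltW e'0)) => t th.
have /rP[Uy ky] : ball x r (p k + t *: delta_mx k ord0).
  split=> // i l; rewrite [l]ord1 /ball /= !mxE andbT.
  rewrite -addrA opprD addrA subrr sub0r normrN.
  case: (ltngtP i k) => ik; rewrite -val_eqE /=.
  - by rewrite (ltn_eqF ik) mulr0 addr0.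
  - by rewrite (gtn_eqF ik) mulr0 addr0 normr0.
  - by rewrite ik eqxx mulr1 add0r (le_lt_trans th).
split; last exact: ky.
exact: (C1g k).1.
Unshelve. all: by end_near.
Qed.

Lemma is_derive_C1_curve U g (gam : R -> 'cV[R]_d) (t : R) (v : 'cV[R]_d) :
  open U -> Ck_on 1 U g -> U (gam t) -> is_derive t (1:R) gam v ->
  is_derive t (1:R) (g \o gam) (\sum_k v k ord0 * partial k g (gam t)).
Proof.
move=> oU C1g Ugt dgam.
have dg := C1_is_diff oU C1g Ugt.
have dfgam : differentiable gam t by apply/derivable1_diffP.
split.
  by apply/derivable1_diffP; apply: differentiable_comp.
rewrite deriveE; last exact: differentiable_comp.
by rewrite diff_comp// diff_val /= -deriveE// derive_val.
Qed.

End C1.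

(** * Derivatives along plane rotations and their integrals *)

Section rotation_field.
Variables (R : realType) (d : nat).
Implicit Types (i j k : 'I_d) (x : 'cV[R]_d) (U : set 'cV[R]_d) (g : 'cV[R]_d -> R).

Definition rotation_field i j g x : R :=
  x i ord0 * partial j g x - x j ord0 * partial i g x.

Lemma is_derive_rotation i j x (t : R) : i != j ->
  is_derive t (1 : R) (fun s => plane_rotation i j (cos s) (sin s) x)
    (\col_k (plane_rotation i j (cos t) (sin t) x i ord0 * (k == j)%:R
           - plane_rotation i j (cos t) (sin t) x j ord0 * (k == i)%:R)).
Proof.
move=> ij; set v := \col_k _.
have D k : is_derive t (1 : R)
    (fun s => plane_rotation i j (cos s) (sin s) x k ord0) (v k ord0).
  rewrite (_ : (fun _ => _) = (fun s => x k ord0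
      + ((cos s - 1) * x i ord0 - sin s * x j ord0) * (k == i)%:R
      + (sin s * x i ord0 + (cos s - 1) * x j ord0) * (k == j)%:R)); last first.
    by apply/funext => s; rewrite /plane_rotation !shear_coord.
  rewrite mxE !plane_rotation_coord// eqxx [j == i]eq_sym (negbTE ij) eqxx.
  apply: is_derive_eq; rewrite /GRing.scale /=.
  by ring.
have dm : derivable (fun s => plane_rotation i j (cos s) (sin s) x) t (1 : R).
  by apply/derivable_mxP => k l; rewrite [l]ord1; exact: (@ex_derive _ _ _ _ _ _ _ (D k)).
split => //; rewrite derive_mx//; apply/matrixP => k l; rewrite [l]ord1 mxE.
exact: (@derive_val _ _ _ _ _ _ _ (D k)).
Qed.

(** Needed at every angle: angle 0 gives the limit of the difference quotients, the other angles
    give their uniform bound through the mean value theorem. *)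
Lemma is_derive_along_rotation U i j g x (t : R) : i != j ->
  open U -> sphere `<=` U -> Ck_on 1 U g -> sphere x ->
  is_derive t (1 : R) (fun s => g (plane_rotation i j (cos s) (sin s) x))
    (rotation_field i j g (plane_rotation i j (cos t) (sin t) x)).
Proof.
move=> ij oU SU C1g Sx.
have Ut : U (plane_rotation i j (cos t) (sin t) x).
  by apply: SU; apply/(sphere_rotation _ ij (cos2Dsin2 t)).
have := is_derive_C1_curve oU C1g Ut (is_derive_rotation x t ij).
move: (plane_rotation i j (cos t) (sin t) x) => y.
congr (is_derive _ _ _ _); rewrite /rotation_field.
rewrite (bigD1 j)//= (bigD1 i)//= big1 ?addr0 => [|k /andP[kj ki]].
  by rewrite !mxE !eqxx [j == i]eq_sym (negbTE ij) /=; ring.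
by rewrite mxE (negbTE kj) (negbTE ki) /=; ring.
Qed.

Lemma continuous_rotation_field U i j g : Ck_on 1 U g ->
  forall x, U x -> {for x, continuous (rotation_field i j g)}.
Proof.
move=> [_ C1g] x Ux; rewrite /rotation_field.
have c k l : {for x, continuous (fun y : 'cV[R]_d => y k ord0 * partial l g y)}.
  by apply: continuousM; [exact: coord_continuous|have [_ [+ _]] := C1g l; exact].
exact: continuousB (c i j) (c j i).
Qed.

Lemma continuous_measurable_sphere U g : open U -> sphere `<=` U ->
  (forall x, U x -> {for x, continuous g}) -> measurable_fun sphere g.
Proof.
move=> oU SU cg; apply: measurable_funS SU _; first exact: open_measurable_cV.
exact: open_continuous_measurable_cV.
Qed.

Lemma surface_integrable_continuous U g : open U -> sphere `<=` U ->
  (forall x, U x -> {for x, continuous g}) ->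
  surface_measure.-integrable sphere (EFin \o g).
Proof.
move=> oU SU cg.
have [M gM] := continuous_sphere_bounded (fun x Sx => cg x (SU x Sx)).
apply: surface_integrable gM.
exact: continuous_measurable_sphere SU cg.
Qed.

Lemma Rintegral_rotation_field U i j g : i != j ->
  open U -> sphere `<=` U -> Ck_on 1 U g ->
  (\int[surface_measure]_(x in sphere) rotation_field i j g x = 0)%R.
Proof.
move=> ij oU SU C1g; have [cg _] := C1g.
have cL := continuous_rotation_field (i := i) (j := j) C1g.
have [M LM] := continuous_sphere_bounded (fun x Sx => cL x (SU x Sx)).
have [Mg gM] := continuous_sphere_bounded (fun x Sx => cg x (SU x Sx)).
(* The shift by 2 keeps the angles in []0, 1[], below [pi / 2]. Then [cos (t n) > 0], so
   [1 + cos (t n)] is nonzero, as the decomposition into shears requires. *)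
pose t n : R := n.+2%:R^-1.
have t0 n : 0 < t n by rewrite invr_gt0.
have t1 n : t n < 1 by rewrite invf_lt1// ltr1n.
pose rot (s : R) x := plane_rotation i j (cos s) (sin s) x.
have Srot s x : sphere x -> sphere (rot s x).
  by move=> Sx; apply/(sphere_rotation _ ij (cos2Dsin2 s)).
have rot0 x : rot 0 x = x.
  by rewrite /rot /plane_rotation cos0 sin0 subrr !mul0r subrr addr0 !scale0r !addr0.
(* The difference quotients q n have zero integral by rotation invariance and
   converge boundedly to the rotation field. *)
pose q n x := (t n)^-1 * (g (rot (t n) x) - g x).
have igrot n : surface_measure.-integrable sphere (EFin \o (fun x => g (rot (t n) x))).
  apply: (@surface_integrable _ _ _ Mg) => [|x Sx]; last exact/gM/Srot.
  apply: (@measurable_comp _ _ _ _ _ _ sphere) => //.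
  - exact: measurable_sphere.
  - by move=> _ [x Sx <-]; exact: Srot.
  - exact: continuous_measurable_sphere SU cg.
  - by apply: measurable_funTS; exact: measurable_plane_rotation.
have ig : surface_measure.-integrable sphere (EFin \o g).
  exact: surface_integrable_continuous cg.
have iq n : surface_measure.-integrable sphere (EFin \o q n).
  rewrite (_ : _ \o _ = (fun x => (t n)^-1%:E *
    ((EFin \o (fun x => g (rot (t n) x))) x - (EFin \o g) x))%E); last first.
    by apply/funext => x /=; rewrite -EFinB -EFinM.
  by apply: integrableZl; [exact: measurable_sphere|apply: integrableB => //; exact: measurable_sphere].
have q0 n : (\int[surface_measure]_(x in sphere) (q n x)%:E = 0)%E.
  have fq := integrable_fin_num (@measurable_sphere R d) (iq n).
  rewrite -[LHS]fineK//.
  congr (_%:E); rewrite -/(Rintegral _ _ _).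
  have iD : surface_measure.-integrable sphere
      (EFin \o (fun x => g (rot (t n) x) - g x)).
    rewrite (_ : _ \o _ = (fun x =>
      ((EFin \o (fun x => g (rot (t n) x))) x - (EFin \o g) x))%E)//.
    by apply: integrableB => //; exact: measurable_sphere.
  rewrite RintegralZl//; last exact: measurable_sphere.
  rewrite RintegralB//; last exact: measurable_sphere.
  rewrite (@Rintegral_surface_rotation _ _ _ Mg)//.
  - by rewrite subrr mulr0.
  - exact: cos2Dsin2.
  - rewrite gt_eqF// addr_gt0// cos_gt0_pihalf//.
    have := pihalf_ge1 R; have := t0 n; have := t1 n; lra.
  - exact: continuous_measurable_sphere SU cg.
have qL x : sphere x -> q n x @[n --> \oo] --> rotation_field i j g x.
  move=> Sx; have := is_derive_along_rotation 0 ij oU SU C1g Sx.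
  rewrite -/(rot 0 x) rot0 => -[+ <-]; rewrite /derivable /derive.
  have tcvg : t n @[n --> \oo] --> (0 : R)^'.
    have tn0 : t n @[n --> \oo] --> (0 : R).
      by have /= := @cvg_harmonic R; rewrite -cvg_shiftS.
    move=> A A0; have := tn0 _ A0; apply: (@filterS _ \oo) => m; apply.
    exact: lt0r_neq0 (t0 m).
  move=> /(cvg_comp _ _ tcvg); apply: cvg_trans; apply: near_eq_cvg.
  apply: nearW => n; rewrite /q /= addr0 [t n *: 1]mulr1.
  by rewrite -[plane_rotation _ _ (cos 0) _ _]/(rot 0 x) rot0.
(* The quotient equals the rotation field at an intermediate rotation of [x], which is still on the
   sphere. *)
have qM n x : sphere x -> `|q n x| <= M.
  move=> Sx.
  pose phi s := g (rot s x).
  have phiP s : is_derive s (1 : R) phi (rotation_field i j g (rot s x)).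
    exact: (is_derive_along_rotation _ ij oU SU C1g Sx).
  have [|c _] := @MVT _ phi (fun s => rotation_field i j g (rot s x)) 0 (t n) (t0 n)
      (fun s _ => phiP s).
    by apply: derivable_within_continuous => s _; apply: (@ex_derive _ _ _ _ _ _ _ (phiP s)).
  rewrite /phi rot0 subr0 /q => ->; rewrite mulrC mulfK ?gt_eqF//.
  exact/LM/Srot.
have [|||||_ _ qcvg] := @dominated_convergence _ _ _ surface_measure sphere
  (@measurable_sphere R d) (fun n => EFin \o q n) (EFin \o rotation_field i j g) (cst M%:E).
- by move=> n; exact: (measurable_int _ (iq n)).
- by apply/measurable_EFinP; exact: continuous_measurable_sphere SU cL.
- by apply: aeW => x Sx; apply: cvg_EFin; [exact: nearW|exact: qL].
- by apply: (@surface_integrable _ _ (cst M) `|M|) => // x _.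
- by apply: aeW => x n Sx; rewrite /= lee_fin; exact: qM.
rewrite /Rintegral; move: qcvg => /cvg_lim <- //.
under eq_fun do rewrite q0.
by rewrite lim_cst.
Qed.

End rotation_field.

(** * Rules for computing continuous partial derivatives *)

Section C1_calculus.
Variables (R : realType) (d : nat) (U : set 'cV[R]_d).
Hypothesis oU : open U.
Implicit Types (g h : 'cV[R]_d -> R) (dg dh : 'I_d -> 'cV[R]_d -> R) (x : 'cV[R]_d).

(* The values of [dg] off [U] are irrelevant. *)
Definition has_C1_partials g dg : Prop :=
  (forall x, U x -> {for x, continuous g}) /\
  forall j, (forall x, U x -> is_derive x (delta_mx j ord0) g (dg j x)) /\
            (forall x, U x -> {for x, continuous (dg j)}).

Lemma continuous_eq_open g h x : U x -> (forall y, U y -> g y = h y) ->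
  {for x, continuous g} -> {for x, continuous h}.
Proof.
move=> Ux gh cg; rewrite /prop_for /continuous_at -(gh x Ux); apply: cvg_trans cg.
apply: (@near_eq_cvg _ _ _ (nbhs_filter x)); have Ux' : nbhs x U by rewrite nbhsE; exists U.
by apply: filterS Ux' => y; exact: gh.
Qed.

(** [Ck_on] asks for continuity of [partial j g], which is known to equal [dg j] only on [U];
    openness of [U] lets continuity pass from one to the other. *)
Lemma has_C1_partials_Ck g dg : has_C1_partials g dg ->
  Ck_on 1 U g /\ forall j x, U x -> partial j g x = dg j x.
Proof.
move=> [cg dgP].
have E j x : U x -> partial j g x = dg j x.
  by move=> Ux; have [/(_ _ Ux) ? _] := dgP j; rewrite /partial derive_val.
split=> //; split=> // j; have [gj cj] := dgP j; split=> [x /gj[]//|]; split=> // x Ux.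
by apply: (continuous_eq_open Ux _ (cj x Ux)) => y Uy; rewrite E.
Qed.

Lemma Ck_has_C1_partials g : Ck_on 1 U g ->
  has_C1_partials g (fun j => partial j g).
Proof.
move=> [cg C1g]; split=> // j; have [gj [cj _]] := C1g j; split=> // x Ux.
by apply: derivableP; exact: gj.
Qed.

Lemma has_C1_cst (a : R) : has_C1_partials (cst a) (fun _ => cst 0).
Proof.
split=> [x _|j]; first exact: cst_continuous.
by split=> x _; [exact: is_derive_cst|exact: cst_continuous].
Qed.

Lemma has_C1_coord (i : 'I_d) :
  has_C1_partials (fun x => x i ord0) (fun j => cst (i == j)%:R).
Proof.
split=> [x _|j]; first exact: coord_continuous.
split=> x _; last exact: cst_continuous.
have E : (fun k : R => k^-1 *: (((fun y : 'cV[R]_d => y i ord0) \o shift x)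
    (k *: delta_mx j ord0) - x i ord0)) = (fun k => k^-1 * k * (i == j)%:R).
  apply/funext => k /=.
  have -> : (k *: delta_mx j ord0 + x) i ord0 = x i ord0 + k * (i == j)%:R.
    by rewrite addrC shear_coord.
  by rewrite addrAC subrr add0r -mulrA.
have L : k^-1 * k * (i == j)%:R @[k --> (0 : R)^'] --> ((i == j)%:R : R).
  rewrite -[X in _ --> X]mul1r; apply: cvgMr_tmp; apply: cvg_near_cst.
  by near=> k; rewrite mulVf//; near: k; exact: nbhs_dnbhs_neq.
split; first by rewrite /derivable E; apply/cvg_ex; eexists; exact: L.
by rewrite /derive E; exact: cvg_lim.
Unshelve. all: by end_near.
Qed.

Lemma has_C1_add g dg h dh : has_C1_partials g dg -> has_C1_partials h dh ->
  has_C1_partials (fun x => g x + h x) (fun j x => dg j x + dh j x).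
Proof.
move=> [cg dgP] [ch dhP]; split=> [x Ux|j].
  exact: continuousD (cg x Ux) (ch x Ux).
have [gj cgj] := dgP j; have [hj chj] := dhP j; split=> x Ux.
  exact: is_deriveD (gj x Ux) (hj x Ux).
exact: continuousD (cgj x Ux) (chj x Ux).
Qed.

Lemma has_C1_mul g dg h dh : has_C1_partials g dg -> has_C1_partials h dh ->
  has_C1_partials (fun x => g x * h x) (fun j x => g x * dh j x + h x * dg j x).
Proof.
move=> [cg dgP] [ch dhP]; split=> [x Ux|j].
  exact: continuousM (cg x Ux) (ch x Ux).
have [gj cgj] := dgP j; have [hj chj] := dhP j; split=> x Ux.
  exact: is_deriveM (gj x Ux) (hj x Ux).
exact: continuousD (continuousM (cg x Ux) (chj x Ux))
  (continuousM (ch x Ux) (cgj x Ux)).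
Qed.

Lemma has_C1_sum n (g : 'I_n -> 'cV[R]_d -> R) (dg : 'I_n -> 'I_d -> 'cV[R]_d -> R) :
  (forall k, has_C1_partials (g k) (dg k)) ->
  has_C1_partials (fun x => \sum_k g k x) (fun j x => \sum_k dg k j x).
Proof.
elim: n g dg => [|n IH] g dg gP.
  rewrite (_ : (fun _ => _) = cst 0); last by apply/funext => x; rewrite big_ord0.
  rewrite (_ : (fun _ _ => _) = (fun _ => cst 0)); first exact: has_C1_cst.
  by apply/funext => j; apply/funext => x; rewrite big_ord0.
rewrite (_ : (fun x => _) = (fun x => g ord0 x + \sum_k g (lift ord0 k) x)); last first.
  by apply/funext => x; rewrite big_ord_recl.
rewrite (_ : (fun j x => _) =
    (fun j x => dg ord0 j x + \sum_k dg (lift ord0 k) j x)); last first.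
  by apply/funext => j; apply/funext => x; rewrite big_ord_recl.
by apply: has_C1_add => //; apply: IH.
Qed.

Lemma has_C1_expR g dg : has_C1_partials g dg ->
  has_C1_partials (fun x => expR (g x)) (fun j x => expR (g x) * dg j x).
Proof.
move=> gP; have [C1g gE] := has_C1_partials_Ck gP.
move: gP => [cg dgP].
have ce x : U x -> {for x, continuous (fun x => expR (g x))}.
  by move=> Ux; apply: continuous_comp; [exact: cg|exact: continuous_expR].
split=> // j; have [gj cgj] := dgP j; split=> x Ux; last first.
  exact: continuousM (ce x Ux) (cgj x Ux).
have dg' := C1_is_diff oU C1g Ux.
have dgx : differentiable g x by [].
have de : differentiable (@expR R) (g x) by apply/derivable1_diffP.
have dc : differentiable (expR \o g) x by exact: differentiable_comp.
split; first exact: diff_derivable.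
rewrite (deriveE _ dc) diff_comp//= -(deriveE _ dgx) (diff1E de).
by rewrite derive1E derive_val (@derive_val _ _ _ _ _ _ _ (gj x Ux)) mulrC.
Qed.

End C1_calculus.

Lemma integrable_bigsum d (T : measurableType d) (R : realType)
    (mu : {measure set T -> \bar R}) (D : set T) (I : Type) (r : seq I)
    (P : pred I) (g : I -> T -> R) : measurable D ->
  (forall i, P i -> mu.-integrable D (EFin \o g i)) ->
  mu.-integrable D (EFin \o (fun x => \sum_(i <- r | P i) g i x)).
Proof.
move=> mD gi; rewrite (_ : _ \o _ = (fun x => \sum_(i <- r | P i) (g i x)%:E)%E).
  exact: integrable_sum.
by apply/funext => x /=; rewrite sumEFin.
Qed.

Lemma Rintegral_bigsum d (T : measurableType d) (R : realType)
    (mu : {measure set T -> \bar R}) (D : set T) (I : Type) (r : seq I)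
    (P : pred I) (g : I -> T -> R) : measurable D ->
  (forall i, P i -> mu.-integrable D (EFin \o g i)) ->
  (\int[mu]_(x in D) (\sum_(i <- r | P i) g i x) =
   \sum_(i <- r | P i) \int[mu]_(x in D) g i x)%R.
Proof.
move=> mD gi; elim: r => [|i r IH].
  rewrite big_nil (@eq_Rintegral _ _ _ mu D (cst 0)) => [|x _]; last by rewrite big_nil.
  by rewrite Rintegral_cst// mul0r.
rewrite big_cons; case: ifPn => Pi.
  rewrite -IH -RintegralD//; first last.
  - exact: integrable_bigsum.
  - exact: gi.
  by apply: eq_Rintegral => x _; rewrite big_cons Pi.
by rewrite -IH; apply: eq_Rintegral => x _; rewrite big_cons (negbTE Pi).
Qed.

Section Stein_identity.
Variables (R : realType) (d : nat) (U : set 'cV[R]_d).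
Hypotheses (oU : open U) (SU : sphere `<=` U).
Implicit Types (g h : 'cV[R]_d -> R) (x : 'cV[R]_d).

(** The divergence theorem for the tangential part of the field [h e_j]; the factor [d - 1] is the
    curvature term of the sphere. *)
Lemma Rintegral_sphere_divergence (j : 'I_d) h : Ck_on 1 U h ->
  (\int[surface_measure]_(x in sphere)
    (partial j h x - x j ord0 * (\sum_i x i ord0 * partial i h x)
     - (d%:R - 1) * x j ord0 * h x) = 0)%R.
Proof.
move=> C1h.
pose c i x := x i ord0 * h x.
have cP i : Ck_on 1 U (c i) /\ forall k x, U x ->
    partial k (c i) x = x i ord0 * partial k h x + h x * (i == k)%:R.
  exact: (has_C1_partials_Ck oU
    (has_C1_mul (has_C1_coord U i) (Ck_has_C1_partials C1h))).
transitivity (\int[surface_measure]_(x in sphere)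
    (\sum_(i | i != j) rotation_field i j (c i) x))%R.
  apply: eq_Rintegral => x /set_mem Sx.
  have Ux := SU Sx.
  rewrite [RHS](eq_bigr (fun i => x i ord0 ^+ 2 * partial j h x
      - x j ord0 * (x i ord0 * partial i h x) - x j ord0 * h x)); last first.
    move=> i ij; rewrite /rotation_field !(cP i).2// eqxx (negbTE ij) /=.
    by rewrite mulr0 addr0 mulr1; ring.
  (* At [i = j] the two derivative terms cancel and [- x j ord0 * h x] remains. Completing the sum
     thus turns the factor [d] into [d - 1] and makes [\sum_i x i ord0 ^+ 2 = 1] applicable. *)
  have -> : \sum_(i | i != j) (x i ord0 ^+ 2 * partial j h x
      - x j ord0 * (x i ord0 * partial i h x) - x j ord0 * h x) =
      \sum_i (x i ord0 ^+ 2 * partial j h x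
      - x j ord0 * (x i ord0 * partial i h x) - x j ord0 * h x) + x j ord0 * h x.
    by rewrite [in RHS](bigD1 j)//=; ring.
  rewrite !big_split /= !sumrN -mulr_suml -mulr_sumr sumr_const card_ord.
  by rewrite (iffLR (sphereP x) Sx) -mulr_natl; ring.
rewrite Rintegral_bigsum; first last.
- move=> i ij; apply: surface_integrable_continuous oU SU _.
  exact: continuous_rotation_field (cP i).1.
- exact: measurable_sphere.
by rewrite big1// => i ij; exact: Rintegral_rotation_field (cP i).1.
Qed.

(** For positive [p], [s] is the gradient of [log p]. On the sphere the sum over [j] is the
    Laplace-Beltrami operator of [g] plus the inner product of the tangential gradient of [g] with
    [s], so the integrand is the divergence of [p] times that gradient. *)
Lemma Rintegral_weighted_sphere_laplacian g (p : 'cV[R]_d -> R)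
    (s : 'I_d -> 'cV[R]_d -> R) :
  Ck_on 2 U g -> has_C1_partials U p (fun j x => p x * s j x) ->
  (\int[surface_measure]_(x in sphere) (p x * \sum_j
    (partial j (partial j g) x
     - x j ord0 * (\sum_i x i ord0 * partial i (partial j g) x)
     - (d%:R - 1) * x j ord0 * partial j g x
     + partial j g x * (s j x - x j ord0 * \sum_i x i ord0 * s i x))) = 0)%R.
Proof.
move=> [_ C2g] pP.
have gj j : Ck_on 1 U (partial j g) by have [_] := C2g j.
have hP j := has_C1_partials_Ck oU (has_C1_mul pP (Ck_has_C1_partials (gj j))).
transitivity (\int[surface_measure]_(x in sphere) (\sum_j
    (partial j (fun y => p y * partial j g y) x - x j ord0 *
      (\sum_i x i ord0 * partial i (fun y => p y * partial j g y) x)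
     - (d%:R - 1) * x j ord0 * (p x * partial j g x))))%R.
  apply: eq_Rintegral => x /set_mem Sx; rewrite mulr_sumr; apply: eq_bigr => j _.
  have Ux := SU Sx.
  rewrite (hP j).2// [in RHS](eq_bigr (fun i => p x * (x i ord0 * partial i (partial j g) x)
      + p x * partial j g x * (x i ord0 * s i x))) => [|i _]; last first.
    by rewrite (hP j).2//; ring.
  by rewrite big_split /= -!mulr_sumr; ring.
rewrite Rintegral_bigsum; first last.
- move=> j _; apply: surface_integrable_continuous oU SU _ => x Ux.
  have [[cp C1p] _] := hP j.
  apply: continuousB; first apply: continuousB.
  + by have [_ [+ _]] := C1p j; exact.
  + apply: continuousM; first exact: coord_continuous.
    apply: (@cvg_bigsum _ _ (nbhs x)) => i _.
    apply: cvgM; first exact: coord_continuous.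
    by have [_ [+ _]] := C1p i; exact.
  + apply: continuousM; last exact: cp.
    by apply: continuousM; [exact: cst_continuous|exact: coord_continuous].
- exact: measurable_sphere.
by rewrite big1// => j _; apply: Rintegral_sphere_divergence; exact: (hP j).1.
Qed.

End Stein_identity.

(** * The Stein identity for the Fisher-Bingham distribution *)

Section FB_score.
Variables (R : realType) (d : nat) (mu : 'cV[R]_d) (A : 'M[R]_d).
Hypothesis At : A^T = A.
Implicit Types (x y : 'cV[R]_d) (U : set 'cV[R]_d).

(** The gradient of the exponent of [FB_kernel] for symmetric [A]. *)
Definition FB_score y : 'cV[R]_d := mu + 2 *: (A *m y).

Lemma FB_kernel_partials U : open U ->
  has_C1_partials U (FB_kernel mu A)
    (fun j y => FB_kernel mu A y * FB_score y j ord0).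
Proof.
move=> oU.
(* The exponent as an explicit polynomial in the coordinates, so that the sum and product rules
   differentiate it term by term. *)
pose Q y : R := \sum_k mu k ord0 * y k ord0
  + \sum_k \sum_l (A k l * y k ord0) * y l ord0.
have QE : FB_kernel mu A = fun y => expR (Q y).
  apply/funext => y; rewrite /FB_kernel /Q mxE; congr (expR (_ + _)).
    by rewrite mxE; apply: eq_bigr => k _; rewrite mxE.
  rewrite -mulmxA mxE; apply: eq_bigr => k _; rewrite !mxE mulr_sumr.
  by apply: eq_bigr => l _; ring.
have c k := has_C1_coord U k.
have QP := has_C1_add
  (has_C1_sum (fun k => has_C1_mul (has_C1_cst U (mu k ord0)) (c k)))
  (has_C1_sum (fun k => has_C1_sum (fun l =>
    has_C1_mul (has_C1_mul (has_C1_cst U (A k l)) (c k)) (c l)))).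
have := has_C1_expR oU QP.
rewrite QE; congr (has_C1_partials _ _ _); apply/funext => j; apply/funext => y.
congr (_ * _); rewrite /FB_score !mxE /cst; congr (_ + _).
  rewrite (bigD1 j)//= eqxx mulr1 mulr0 addr0 big1 ?addr0// => k kj.
  by rewrite (negbTE kj) !mulr0 addr0.
rewrite mulr_sumr.
(* The coordinate [y j] occurs in both factors of the quadratic form, which produces column and row
   [j] of [A]; symmetry merges them into the factor 2 of [FB_score]. *)
transitivity (\sum_k (A k j * y k ord0 + A j k * y k ord0)); last first.
  by apply: eq_bigr => k _; rewrite -[in A k j]At mxE; ring.
have sum1 (a : 'I_d -> R) : \sum_k a k * (k == j)%:R = a j.
  by rewrite (bigD1 j)//= eqxx mulr1 big1 ?addr0// => k /negbTE ->; rewrite mulr0.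
rewrite big_split /= -[X in _ = X + _](eq_bigr _ (fun k _ => sum1 (fun l => A k l * y k ord0))).
rewrite -(sum1 (fun k => \sum_l A k l * y l ord0)) -big_split /=; apply: eq_bigr => k _.
rewrite mulr_suml -big_split /=; apply: eq_bigr => l _.
by ring.
Qed.

End FB_score.

Section Stein_operator.
Variables (R : realType) (d m : nat) (F : 'cV[R]_d -> 'cV[R]_m).
Implicit Types y : 'cV[R]_d.

(** On the sphere, minus the Laplace-Beltrami operator of [F] in Euclidean derivatives of the
    extension. Its sample mean is [stein_const]. *)
Definition stein_op y : 'cV[R]_m :=
  (d%:R - 1) *: (grad F y *m y) + grad2 F y *m (y *t y : 'cV_(d * d))
  - laplacian F y.

Lemma sum_mxtens (G : 'I_d -> 'I_d -> R) :
  \sum_(r < d * d) G (mxtens_unindex r).1 (mxtens_unindex r).2 =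
  \sum_i \sum_j G i j.
Proof.
rewrite pair_big (reindex (@mxtens_unindex d d))//=.
by exists (@mxtens_index d d) => i _; rewrite (mxtens_indexK, mxtens_unindexK).
Qed.

(** Translates the matrix notation of the estimator into the integrand of
    [Rintegral_weighted_sphere_laplacian], up to sign. *)
Lemma stein_op_sub (s : 'cV[R]_d) y (i : 'I_m) :
  let g := fun z => F z i ord0 in
  (stein_op y - tangent_grad F y *m s) i ord0 = - \sum_j
    (partial j (partial j g) y
     - y j ord0 * (\sum_k y k ord0 * partial k (partial j g) y)
     - (d%:R - 1) * y j ord0 * partial j g y
     + partial j g y * (s j ord0 - y j ord0 * \sum_k y k ord0 * s k ord0)).
Proof.
move=> g.
have tE : (tangent_grad F y *m s) i ord0 = \sum_j partial j g y *
    (s j ord0 - y j ord0 * \sum_k y k ord0 * s k ord0).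
  rewrite /tangent_grad -mulmxA mulmxBl mul1mx -mulmxA mxE; apply: eq_bigr => j _.
  rewrite !mxE big_ord1; congr (_ * (_ - _ * _)).
  by rewrite mxE; apply: eq_bigr => k _; rewrite mxE.
have hE : (grad2 F y *m (y *t y : 'cV_(d * d))) i ord0 =
    \sum_j y j ord0 * \sum_k y k ord0 * partial k (partial j g) y.
  rewrite mxE; under [RHS]eq_bigr do rewrite mulr_sumr.
  rewrite -(sum_mxtens (fun j k => y j ord0 * (y k ord0 * partial k (partial j g) y))).
  apply: eq_bigr => r _; rewrite !mxE !ord1 /=; ring.
have E (a : R) (A B C T : 'cV[R]_m) :
    (a *: A + B - C - T) i ord0 = a * A i ord0 + B i ord0 - C i ord0 - T i ord0.
  by rewrite !mxE.
have gE : (grad F y *m y) i ord0 = \sum_j partial j g y * y j ord0.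
  by rewrite mxE; apply: eq_bigr => j _; rewrite mxE.
have lE : laplacian F y i ord0 = \sum_j partial j (partial j g) y by rewrite mxE.
rewrite /stein_op E tE hE gE lE mulr_sumr -!sumrN -!big_split /=.
by apply: eq_bigr => j _; ring.
Qed.

(* [- FB_kernel] is also a kernel with score [FB_score]; it absorbs the sign in
   [stein_op_sub]. *)
Lemma Rintegral_FB_stein_op U mu (A : 'M[R]_d) (i : 'I_m) : A^T = A ->
  open U -> sphere `<=` U -> smooth_on U (fun y => F y i ord0) ->
  (\int[surface_measure]_(y in sphere) (FB_kernel mu A y *
    (stein_op y - tangent_grad F y *m FB_score mu A y) i ord0) = 0)%R.
Proof.
move=> At oU SU sF.
have kP : has_C1_partials U (fun y => -1 * FB_kernel mu A y)
    (fun j y => -1 * FB_kernel mu A y * FB_score mu A y j ord0).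
  have := has_C1_mul (has_C1_cst U (-1)) (FB_kernel_partials mu At oU).
  congr (has_C1_partials _ _ _); apply/funext => j; apply/funext => y.
  by rewrite /cst mulr0 addr0 mulrA.
rewrite -[RHS](Rintegral_weighted_sphere_laplacian oU SU (sF 2) kP).
by apply: eq_Rintegral => y _; rewrite stein_op_sub; ring.
Qed.

End Stein_operator.

HB.instance Definition _ (R : realType) (d : nat) :=
  @Measure_isFinite.Build _ _ R (@surface_measure R d) (fun B mB =>
    eq_ind_r is_true (surface_measure_lty mB) (ge0_fin_numE (measure_ge0 _ B))).

(** [p] and the Radon-Nikodym derivative of [nu] have the same integral over every measurable set,
    hence agree almost everywhere. *)
Lemma integral_density d (T : measurableType d) (R : realType)
    (mu : {sigma_finite_measure set T -> \bar R})
    (nu : {finite_measure set T -> \bar R}) (p f : T -> \bar R) :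
  measurable_fun setT p ->
  (forall A, measurable A -> nu A = \int[mu]_(x in A) p x)%E ->
  nu.-integrable setT f ->
  (\int[nu]_x f x = \int[mu]_x (f x * p x))%E.
Proof.
move=> mp nup fi.
have dom : nu `<< mu.
  apply/null_content_dominatesP => A mA muA0; rewrite nup//.
  by apply: null_set_integral => //; exact: measurable_funTS.
rewrite -(Radon_Nikodym_change_of_variables dom)//.
apply: ae_eq_integral => //.
- apply: emeasurable_funM; first exact: measurable_int fi.
  exact: measurable_int (Radon_Nikodym_integrable _).
- by apply: emeasurable_funM => //; exact: measurable_int fi.
- apply: ae_eqe_mul2l; rewrite (@Radon_NikodymE _ _ _ (charge_of_finite_measure nu) _ dom) /=.
  case: cid => /= h [h1 h2 h3]; apply: integral_ae_eq => //.
  by move=> E _ mE; rewrite -h3// -nup.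
Qed.

Section FB_expectation.
Variables (R : realType) (d : nat) (mu : 'cV[R]_d) (A : 'M[R]_d).

Lemma continuous_FB_kernel (x : 'cV[R]_d) : {for x, continuous (FB_kernel mu A)}.
Proof.
rewrite /FB_kernel.
apply: (@continuous_comp _ _ _ (fun x => (mu^T *m x + x^T *m A *m x) ord0 ord0));
  last exact: continuous_expR.
rewrite (_ : (fun x => _) = (fun x : 'cV[R]_d => \sum_k mu k ord0 * x k ord0
  + \sum_k (\sum_l x l ord0 * A l k) * x k ord0)); last first.
  apply/funext => y; rewrite mxE [X in X + _]mxE [X in _ + X]mxE; congr (_ + _).
    by apply: eq_bigr => k _; rewrite mxE.
  by apply: eq_bigr => k _; rewrite mxE; congr (_ * _); apply: eq_bigr => l _; rewrite mxE.
apply: continuousD; apply: (@cvg_bigsum _ _ (nbhs x)) => k _.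
  by apply: cvgM; [exact: cvg_cst|exact: coord_continuous].
apply: cvgM; last exact: coord_continuous.
apply: (@cvg_bigsum _ _ (nbhs x)) => l _.
by apply: cvgM; [exact: coord_continuous|exact: cvg_cst].
Qed.

Variables (dO : measure_display) (Omega : measurableType dO).
Variables (P : probability Omega R) (X : {RV P >-> 'cV[R]_d}).
Hypothesis XS : forall w, sphere (X w).
Hypothesis Xlaw : forall B : set 'cV[R]_d, measurable B ->
  distribution P X B = FB mu A B.

Lemma measurable_comp_sphere (g : 'cV[R]_d -> R) :
  measurable_fun sphere g -> measurable_fun setT (fun w => g (X w)).
Proof.
move=> mg; apply: (@measurable_comp _ _ _ _ _ _ sphere) => //.
- exact: measurable_sphere.
- by move=> _ [w _ <-].
Qed.

(** Keeping the normalizing constant as a factor in front lets it disappear once the surface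
    integral is shown to be 0. *)
Lemma Rintegral_FB (g : 'cV[R]_d -> R) (M : R) :
  measurable_fun sphere g -> (forall x, sphere x -> `|g x| <= M) ->
  (\int[P]_w g (X w) =
   (FB_const mu A)^-1 * \int[surface_measure]_(x in sphere) (FB_kernel mu A x * g x))%R.
Proof.
move=> mg gM.
have mS := @measurable_sphere R d.
have mK : measurable_fun sphere (FB_kernel mu A).
  apply: (@continuous_measurable_sphere _ _ setT) => //; first exact: openT.
  by move=> x _; exact: continuous_FB_kernel.
have [K KM] := continuous_sphere_bounded (fun x (_ : sphere x) => @continuous_FB_kernel x).
pose g' := g \_ sphere.
have mg' : measurable_fun setT g' by apply/(measurable_restrictT _ _).1.
(* [FB] integrates over the sphere only, so as a law on the whole space its density is [FB_density]
   cut off outside the sphere. *)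
have mp : measurable_fun setT ((fun x => (FB_density mu A x)%:E) \_ sphere)%E.
  apply/(measurable_restrictT _ _).1 => //; apply/measurable_EFinP.
  exact: measurable_funM.
have g'X w : g' (X w) = g (X w) by rewrite /g' patchE mem_set.
have ig' : P.-integrable setT (EFin \o g' \o X).
  apply: (@measurable_bounded_integrable _ _ _ _ (g' \o X)) => //.
  - by rewrite (le_lt_trans (probability_le1 _ _))// ltry.
  - exact: measurableT_comp.
  - exists M; split; first exact: num_real.
    move=> r Mr w _; rewrite /= g'X; apply: le_trans (gM _ (XS w)) _; exact: ltW.
transitivity (fine (\int[P]_w (g' (X w))%:E)).
  by congr fine; apply: eq_integral => w _; rewrite g'X.
have mE : measurable_fun setT (EFin \o g') by exact/measurable_EFinP.
rewrite -(integral_distribution mE ig').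
rewrite (@integral_density _ _ _ surface_measure _
   ((fun x => (FB_density mu A x)%:E) \_ sphere)%E)//; first last.
- exact: (integrable_pushforward _ mE ig').
- move=> B mB; transitivity (FB mu A B); first exact: Xlaw.
  by rewrite /FB setIC integral_mkcondr.
rewrite -RintegralZl//; last first.
  apply: (@surface_integrable _ _ _ (K * M)); first exact: measurable_funM.
  by move=> x Sx; rewrite normrM ler_pM// ?KM ?gM.
rewrite /Rintegral [in RHS]integral_mkcond; congr fine; apply: eq_integral => x _ /=.
rewrite !patchE; case: ifPn => xS; last by rewrite mule0.
rewrite /g' patchE xS -EFinM /FB_density; congr (_%:E); ring.
Qed.

End FB_expectation.

(** * A strong law of large numbers for bounded functions *)

Section bounded_averages.
Variable R : realType.
Implicit Types (z : nat -> R) (B : R).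

Lemma sqr_bracket (n : nat) : exists k, (k ^ 2 <= n < k.+1 ^ 2)%N.
Proof.
elim: n => [|n [k /andP[kn nk]]]; first by exists 0%N.
have [nk1|nk1] := ltnP n.+1 (k.+1 ^ 2); first by exists k; rewrite nk1 leqW.
exists k.+1; rewrite nk1 /=; apply: leq_ltn_trans nk _.
by rewrite ltn_exp2r.
Qed.

(** Between [(k + 1)^2] and [n < (k + 2)^2] there are at most [2 (k + 1)] further terms, each
    bounded by [B]; after division by [n] they contribute at most [2 B / (k + 1)]. *)
Lemma cvg_average_squares z B : (forall i, `|z i| <= B) ->
  ((k.+1 ^ 2)%:R^-1 * \sum_(i < k.+1 ^ 2) z i) @[k --> \oo] --> (0 : R) ->
  n%:R^-1 * \sum_(i < n) z i @[n --> \oo] --> (0 : R).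
Proof.
move=> zB sq0; have B0 : 0 <= B by apply: le_trans (zB 0%N).
apply/cvgr0Pnorm_le => e e0.
have e2 : 0 < e / 2 by rewrite divr_gt0.
have /cvgr0Pnorm_le/(_ _ e2)[K1 _ K1P] := sq0.
pose K2 := (Num.truncn (4 * B / e)).+1.
have K2P k : (K2 <= k)%N -> 2 * B / k.+1%:R <= e / 2.
  move=> Kk; rewrite ler_pdivrMr//.
  have : 4 * B / e < K2%:R by rewrite truncnS_gt.
  rewrite ltr_pdivrMr// => h.
  have : K2%:R * e <= k.+1%:R * e by rewrite ler_pM2r// ler_nat leqW.
  lra.
pose K := maxn K1 K2.
(* Beyond this threshold the square root of the bracketing square is some [k.+1] with [K <= k]. *)
exists (K.+1 ^ 2)%N => // n /= Kn.
have [[|k] /andP[kn nk]] := sqr_bracket n.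
  by move: (leq_ltn_trans Kn nk); rewrite ltn_exp2r.
have Kk : (K <= k)%N.
  by have := leq_ltn_trans Kn nk; rewrite ltn_exp2r// ltnS ltnS.
have [K1k K2k] : (K1 <= k)%N /\ (K2 <= k)%N by apply/andP; rewrite -geq_max.
have n0 : (0 < n)%N by apply: leq_trans kn; rewrite expn_gt0.
set q := (k.+1 ^ 2)%N in kn nk *.
have q0 : (0 < q)%N by rewrite expn_gt0.
have -> : \sum_(i < n) z i = \sum_(i < q) z i + \sum_(q <= i < n) z i.
  by rewrite -!(big_mkord xpredT) (big_cat_nat (n := q)).
rewrite mulrDr (le_trans (ler_normD _ _))// (splitr e) lerD//.
  apply: le_trans (K1P k K1k); rewrite !normrM ler_wpM2r//.
  by rewrite !normfV !normr_nat lef_pV2 ?posrE ?ltr0n// ler_nat.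
apply: le_trans (K2P _ K2k).
rewrite normrM normfV normr_nat.
have -> : 2 * B / k.+1%:R = q%:R^-1 * (2 * k.+1%:R * B).
  rewrite /q natrX; have : (k.+1%:R : R) != 0 by rewrite pnatr_eq0.
  by move=> k0; field.
apply: ler_pM => //.
  by rewrite lef_pV2 ?posrE ?ltr0n// ler_nat.
rewrite (le_trans (ler_norm_sum _ _ _))//.
rewrite (le_trans (ler_sum _ (fun i _ => zB i)))// sumr_const_nat -[leLHS]mulr_natl.
rewrite ler_wpM2r// -natrM ler_nat leq_subLR.
have : (k.+2 ^ 2 = q + 2 * k.+1 + 1)%N by rewrite /q; ring.
by move: nk => /[swap] ->; rewrite addn1 ltnS.
Qed.

Lemma sum_inv_sqr_le2 (n : nat) : \sum_(k < n) (k.+1%:R ^+ 2)^-1 <= 2 :> R.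
Proof.
(* The stronger bound makes the induction close, since [(a + 1)^-2 <= a^-1 - (a + 1)^-1] for
   positive [a]. *)
suff : \sum_(k < n.+1) (k.+1%:R ^+ 2)^-1 <= 2 - n.+1%:R^-1 :> R.
  rewrite big_ord_recr /= ; have : 0 <= (n.+1%:R ^+ 2)^-1 :> R by rewrite invr_ge0 sqr_ge0.
  have : 0 <= n.+1%:R^-1 :> R by rewrite invr_ge0.
  move: (\sum_(i < n) _) (_ ^- 2) (_^-1) => a b c h1 h2; move: h1 h2; lra.
elim: n => [|n IH]; first by rewrite big_ord1 /= expr1n !invr1 lerBrDr.
rewrite big_ord_recr /=.
suff : (n.+2%:R ^+ 2)^-1 <= n.+1%:R^-1 - n.+2%:R^-1 :> R.
  by move: IH; move: (\sum_(i < n.+1) _) (_ ^- 2) (n.+1%:R^-1) (n.+2%:R^-1) => a b c e; lra.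
rewrite -[n.+2%:R]natr1; have : 0 < n.+1%:R :> R by rewrite ltr0n.
move: n.+1%:R => a a0; have a1 : 0 < a + 1 by rewrite addr_gt0.
have -> : a^-1 - (a + 1)^-1 = (a * (a + 1))^-1.
  by field; rewrite !gt_eqF.
by rewrite lef_pV2 ?posrE ?mulr_gt0 ?exprn_gt0// expr2 ler_pM2r// lerDl.
Qed.

End bounded_averages.

Lemma bounded_integrable d (T : measurableType d) (R : realType)
    (mu : {finite_measure set T -> \bar R}) (Y : T -> R) (M : R) :
  measurable_fun setT Y -> (forall w, `|Y w| <= M) ->
  mu.-integrable setT (EFin \o Y).
Proof.
move=> mY YM; apply: measurable_bounded_integrable => //.
  by rewrite ltey_eq fin_num_measure.
exists M; split; first exact: num_real.
by move=> r Mr w _; apply: le_trans (YM w) _; exact: ltW.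
Qed.

Section strong_law.
Context dO (Omega : measurableType dO) (R : realType) (P : probability Omega R).
Context dT (T : measurableType dT).

(** The joint law agrees with the product of the two laws on rectangles, hence everywhere; Fubini
    then factors the integral. *)
Lemma Rintegral_indep_mul (X1 X2 : {RV P >-> T}) (f g : T -> R) (M N : R) :
  (forall A B, measurable A -> measurable B ->
     P (X1 @^-1` A `&` X2 @^-1` B) = P (X1 @^-1` A) * P (X2 @^-1` B))%E ->
  measurable_fun setT f -> measurable_fun setT g ->
  (forall x, `|f x| <= M) -> (forall x, `|g x| <= N) ->
  (\int[P]_w (f (X1 w) * g (X2 w)) =
   \int[P]_w f (X1 w) * \int[P]_w g (X2 w))%R.
Proof.
move=> ind mf mg fM gN.
pose nu1 : probability T R := distribution P X1.
pose nu2 : probability T R := distribution P X2.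
pose X12 w := (X1 w, X2 w).
have mX12 : measurable_fun setT X12 by exact/measurable_fun_pair.
pose h (p : T * T) : R := f p.1 * g p.2.
have mh : measurable_fun setT h.
  by apply: measurable_funM; apply: measurableT_comp.
have hMN p : `|h p| <= M * N by rewrite normrM ler_pM.
have mE (k : T -> R) : measurable_fun setT k -> measurable_fun setT (EFin \o k).
  by move=> mk; exact/measurable_EFinP.
have dE (X : {RV P >-> T}) (k : T -> R) (K : R) : measurable_fun setT k -> (forall x, `|k x| <= K) ->
    (\int[P]_w k (X w) = \int[distribution P X]_x k x)%R.
  move=> mk kK; congr fine.
  rewrite (@integral_distribution _ _ _ _ _ P X (EFin \o k))//; first exact: mE.
  by apply: (@bounded_integrable _ _ _ _ (k \o X) K) => [|w];
    [exact: measurableT_comp|exact: kK].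
have prodE A : measurable A -> pushforward P X12 A = (nu1 \x nu2)%E A.
  pose m' : {measure set (T * T) -> \bar R} :=
    measure_function_pushforward__canonical__measure_function_Measure P mX12.
  move=> mA; apply/esym/(product_measure_unique (m' := m')) => //.
pose nu12 : probability (T * T)%type R := (nu1 \x nu2)%E.
have ih : (nu1 \x nu2)%E.-integrable setT (EFin \o h).
  exact: (@bounded_integrable _ _ _ nu12 _ _ mh hMN).
transitivity (\int[(nu1 \x nu2)%E]_p h p)%R.
  congr fine.
  transitivity (\int[pushforward P X12]_p (h p)%:E)%E; last first.
    by apply: eq_measure_integral => A mA _; exact: prodE.
  rewrite integral_pushforward//; first exact/measurable_EFinP.
  by apply: (@bounded_integrable _ _ _ _ (h \o X12) (M * N)) => [|w];
    [exact: measurableT_comp|exact: hMN].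
rewrite (dE _ f M)// (dE _ g N)//.
have ig : nu2.-integrable setT (EFin \o g) by exact: bounded_integrable gN.
rewrite /Rintegral -integral12_prod_meas1//=.
transitivity (fine (\int[nu1]_x ((f x)%:E * \int[nu2]_y (g y)%:E))%E).
  congr fine; apply: eq_integral => x _ /=.
  by rewrite -[RHS](integralZl measurableT ig (f x)).
have if1 : nu1.-integrable setT (EFin \o f) by exact: bounded_integrable fM.
have gf := integrable_fin_num measurableT ig.
have ff := integrable_fin_num measurableT if1.
by rewrite -{1}(fineK gf) (integralZr measurableT if1) fineM.
Qed.

End strong_law.

Lemma nneseries_fin_cvg0 (R : realType) (u : nat -> R) : (forall k, 0 <= u k) ->
  (\sum_(k <oo) (u k)%:E)%E \is a fin_num -> u k @[k --> \oo] --> (0 : R).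
Proof.
move=> u0 sf; apply: cvg_series_cvg_0; apply: nondecreasing_is_cvgn.
  apply/nondecreasing_seqP => n; rewrite /series /= big_nat_recr//= lerDl.
  exact: u0.
exists (fine (\sum_(k <oo) (u k)%:E)%E) => _ [n _ <-].
rewrite -lee_fin fineK// /series /= -sumEFin.
by apply: nneseries_lim_ge => k _ _; rewrite lee_fin.
Qed.

Section strong_law.
Context dO (Omega : measurableType dO) (R : realType) (P : probability Omega R).
Context dT (T : measurableType dT).

Lemma mutually_independent_pair (X : nat -> {RV P >-> T}) (i j : nat)
    (A B : set T) : mutually_independent X -> i != j ->
  measurable A -> measurable B ->
  P (X i @^-1` A `&` X j @^-1` B) = (P (X i @^-1` A) * P (X j @^-1` B))%E.
Proof.
move=> ind ij mA mB; have ji : j != i by rewrite eq_sym.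
have := ind [:: i; j] (fun k => if k == i then A else B).
rewrite /= inE ij !big_cons big_nil mule1 eqxx (negbTE ji) => <-//; last first.
  by move=> k; case: ifP.
congr (P _); apply/seteqP; split => [w [Ai Bj] k|w AB].
  by rewrite /= !inE => /orP[/eqP|/eqP] ->; rewrite ?eqxx ?(negbTE ji).
split; first by have := AB i; rewrite /= !inE eqxx => /(_ isT).
by have := AB j; rewrite /= !inE eqxx (negbTE ji) orbT => /(_ isT).
Qed.

(* The second moment of the average of n terms is O(1/n), hence summable along
   n = k^2; boundedness fills the gaps between consecutive squares. *)
Lemma strong_law_bounded (X : nat -> {RV P >-> T}) (g : T -> R) (M m : R) :
  mutually_independent X -> measurable_fun setT g -> (forall x, `|g x| <= M) ->
  (forall i, \int[P]_w g (X i w) = m)%R ->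
  {ae P, forall w, n%:R^-1 * \sum_(i < n) g (X i w) @[n --> \oo] --> m}.
Proof.
move=> ind mg gM gm.
pose Z x := g x - m; pose B := M + `|m|.
have ZB x : `|Z x| <= B by rewrite (le_trans (ler_normB _ _))// lerD2r.
have B0 : 0 <= B.
  by rewrite addr_ge0// (le_trans _ (gM point)).
have mZ : measurable_fun setT Z by exact: measurable_funB.
have mZX i : measurable_fun setT (fun w => Z (X i w)) by exact: measurableT_comp mZ _.
have cstE r : (\int[P]_w (cst r) w = r :> R)%R.
  rewrite Rintegral_cst//.
  by rewrite [X in fine X](_ : _ = 1%E) ?mulr1//; exact: probability_setT.
have EZ i : (\int[P]_w Z (X i w) = 0)%R.
  rewrite RintegralB//; last 2 first.
  - apply: (@bounded_integrable _ _ _ _ (fun w => g (X i w)) M) => //.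
    exact: measurableT_comp.
  - exact: (@bounded_integrable _ _ _ _ (cst m) `|m|).
  by rewrite gm cstE subrr.
have iZZ i j : P.-integrable setT (EFin \o (fun w => Z (X i w) * Z (X j w))).
  apply: (@bounded_integrable _ _ _ _ _ (B * B)) => [|w].
    exact: measurable_funM.
  by rewrite normrM ler_pM.
have EZZ i j : i != j -> (\int[P]_w (Z (X i w) * Z (X j w)) = 0)%R.
  move=> ij; rewrite (Rintegral_indep_mul _ mZ mZ ZB ZB) ?EZ ?mulr0//.
  by move=> C D mC mD; exact: mutually_independent_pair.
have EZ2 i : (\int[P]_w (Z (X i w) * Z (X i w)) <= B ^+ 2)%R.
  have -> : B ^+ 2 = (\int[P]_w cst (B ^+ 2) w)%R.
    by rewrite cstE.
  apply: le_Rintegral => //; first exact: (@bounded_integrable _ _ _ _ (cst (B ^+ 2)) `|B ^+ 2|).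
  move=> w _ /=; rewrite -expr2 -real_normK ?num_real//.
  by rewrite lerXn2r ?nnegrE.
pose S n w := \sum_(i < n) Z (X i w).
(* Off-diagonal products have zero mean by [EZZ], which leaves [n] diagonal terms. *)
have SE n : (\int[P]_w (S n w ^+ 2) <= n%:R * B ^+ 2)%R.
  rewrite (@eq_Rintegral _ _ _ P setT
    (fun w => \sum_(i < n) \sum_(j < n) (Z (X i w) * Z (X j w)))) => [|w _]; last first.
    by rewrite expr2 /S big_distrlr.
  rewrite Rintegral_bigsum//; last by move=> i _; exact: integrable_bigsum.
  rewrite mulr_natl -[leRHS]/(B ^+ 2 *+ n) -[n in leRHS]card_ord -sumr_const.
  apply: ler_sum => i _; rewrite Rintegral_bigsum//.
  by rewrite (bigD1 i)//= big1 ?addr0// => j ji; rewrite EZZ// eq_sym.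
pose q k := (k.+1 ^ 2)%N.
pose h k w := ((q k)%:R^-1 * S (q k) w) ^+ 2.
have mS n : measurable_fun setT (S n) by exact: measurable_sum.
have mh k : measurable_fun setT (h k).
  by apply: measurable_funX; exact: measurable_funM.
have SB n w : `|S n w| <= n%:R * B.
  rewrite (le_trans (ler_norm_sum _ _ _))// (le_trans (ler_sum _ (fun i _ => ZB _)))//.
  by rewrite sumr_const card_ord mulr_natl.
have iS2 n : P.-integrable setT (EFin \o (fun w => S n w ^+ 2)).
  apply: (@bounded_integrable _ _ _ _ _ ((n%:R * B) ^+ 2)) => [|w].
    exact: measurable_funX.
  by rewrite normrX lerXn2r ?nnegrE// mulr_ge0.
have Eh k : (\int[P]_w (h k w)%:E <= ((k.+1%:R ^+ 2)^-1 * B ^+ 2)%:E)%E.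
  pose S2 w := S (q k) w ^+ 2.
  rewrite (eq_integral (fun w => ((q k)%:R^-1 ^+ 2)%:E * (EFin \o S2) w)%E);
    last by move=> w _; rewrite /h exprMn EFinM.
  have iS2k : P.-integrable setT (EFin \o S2) by exact: iS2.
  rewrite (integralZl measurableT iS2k).
  rewrite -(fineK (integrable_fin_num measurableT iS2k)) -EFinM lee_fin.
  apply: le_trans (ler_wpM2l _ (SE (q k))) _; first exact: sqr_ge0.
  have -> : (q k)%:R = k.+1%:R ^+ 2 :> R by rewrite /q natrX.
  rewrite mulrA ler_wpM2r ?sqr_ge0//.
  by rewrite expr2 -mulrA mulVf ?mulr1// expf_neq0.
(* By monotone convergence the expected series is at most [2 * B ^+ 2]; hence the series is finite
   almost surely and its terms tend to 0. *)
have sumh : (\int[P]_w (\sum_(k <oo) (h k w)%:E) < +oo)%E.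
  rewrite integral_nneseries//; first last.
  - by move=> k w _; rewrite lee_fin sqr_ge0.
  - by move=> k; exact/measurable_EFinP.
  apply: (@le_lt_trans _ _ (2 * B ^+ 2)%:E); last exact: ltry.
  apply: lime_le.
    apply: is_cvg_nneseries => k _ _; apply: integral_ge0 => w _.
    by rewrite lee_fin sqr_ge0.
  apply: nearW => n; rewrite (le_trans (lee_sum _ (fun k _ => Eh k)))//.
  rewrite sumEFin lee_fin -mulr_suml ler_wpM2r ?sqr_ge0// big_mkord.
  exact: sum_inv_sqr_le2.
have isum : P.-integrable setT (fun w => \sum_(k <oo) (h k w)%:E)%E.
  apply/integrableP; split.
    apply: ge0_emeasurable_sum => [k w _ _|k _]; first by rewrite lee_fin sqr_ge0.
    exact/measurable_EFinP.
  under eq_integral => w _.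
    rewrite gee0_abs; first over.
    by apply: nneseries_ge0 => k _ _; rewrite lee_fin sqr_ge0.
  by [].
have := integrable_ae measurableT isum; apply: filterS => w /(_ I) fw.
have h0 : h k w @[k --> \oo] --> (0 : R).
  by apply: nneseries_fin_cvg0 => // k; rewrite sqr_ge0.
have S0 : n%:R^-1 * \sum_(i < n) Z (X i w) @[n --> \oo] --> (0 : R).
  apply: (@cvg_average_squares _ (fun i => Z (X i w)) B (fun i => ZB _)).
  apply/cvgr0Pnorm_le => e e0.
  have /cvgr0Pnorm_le/(_ _ (exprn_gt0 2 e0)) := h0; apply: filterS => k.
  by rewrite /h normrX ler_pXn2r ?nnegrE// ltW.
have : n%:R^-1 * \sum_(i < n) Z (X i w) + m @[n --> \oo] --> (0 + m : R).
  by apply: cvgD => //; exact: cvg_cst.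
rewrite add0r; apply: cvg_trans; apply: near_eq_cvg.
(* At [n = 0] one side is 0 and the other is [m], so agreement starts at 1. *)
exists 1%N => // n /= n1.
rewrite /Z big_split /= sumr_const card_ord -[- m *+ n]mulr_natl mulrDr.
by rewrite mulrA mulVf ?mul1r ?subrK// pnatr_eq0 -lt0n.
Qed.

End strong_law.

(** * Consistency of the Stein estimator *)

Section matrix_convergence.
Variables (R : realType) (T : Type) (F : set_system T).
Context {FF : ProperFilter F}.

Lemma cvg_mxP p q (M : T -> 'M[R]_(p, q)) (L : 'M[R]_(p, q)) :
  M t @[t --> F] --> L <-> forall i j, M t i j @[t --> F] --> L i j.
Proof.
split=> [ML i j|ML A [Q QL QA]].
  exact: (cvg_comp _ _ ML (coord_continuous (i := i) (j := j) (x := L))).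
have : \forall t \near F, forall i j, Q i j (M t i j).
  by apply: filter_forall => i; apply: filter_forall => j; exact: ML (QL i j).
by apply: filterS => t; exact: QA.
Qed.

Lemma cvg_mulmx p q r (M : T -> 'M[R]_(p, q)) (N : T -> 'M[R]_(q, r))
    (L : 'M[R]_(p, q)) (K : 'M[R]_(q, r)) :
  M t @[t --> F] --> L -> N t @[t --> F] --> K -> M t *m N t @[t --> F] --> L *m K.
Proof.
move=> /cvg_mxP ML /cvg_mxP NK; apply/cvg_mxP => i j; rewrite mxE.
under eq_fun do rewrite mxE.
by apply: cvg_bigsum => k _; exact: cvgM.
Qed.

Lemma cvg_det p (M : T -> 'M[R]_p) (L : 'M[R]_p) :
  M t @[t --> F] --> L -> \det (M t) @[t --> F] --> \det L.
Proof.
move=> /cvg_mxP ML; apply: cvg_bigsum => s _; apply: cvgMl_tmp.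
by apply: cvg_bigprod => i _; exact: ML.
Qed.

Lemma near_unitmx p (M : T -> 'M[R]_p) (L : 'M[R]_p) : L \in unitmx ->
  M t @[t --> F] --> L -> \forall t \near F, M t \in unitmx.
Proof.
rewrite unitmxE unitfE => L0 /cvg_det dM.
have det0 : \forall t \near F, \det (M t) != 0 by exact: cvgr_neq0 dM L0.
by apply: filterS det0 => t; rewrite unitmxE unitfE.
Qed.

(** Cramer's formula is continuous where the determinant is nonzero. [invmx] is given by it on
    invertible matrices, and the [M t] are eventually invertible. *)
Lemma cvg_invmx p (M : T -> 'M[R]_p) (L : 'M[R]_p) : L \in unitmx ->
  M t @[t --> F] --> L -> invmx (M t) @[t --> F] --> invmx L.
Proof.
move=> uL ML; have L0 : \det L != 0 by rewrite -unitfE -unitmxE.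
have : (\det (M t))^-1 *: \adj (M t) @[t --> F] --> (\det L)^-1 *: \adj L.
  apply/cvg_mxP => i j; rewrite !mxE; under eq_fun do rewrite !mxE.
  apply: cvgM; first by apply: cvgV => //; exact: cvg_det.
  apply: cvgMl_tmp; apply: cvg_det; apply/cvg_mxP => k l; rewrite !mxE.
  by under eq_fun do rewrite !mxE; move/cvg_mxP : ML; exact.
have -> : (\det L)^-1 *: \adj L = invmx L by rewrite /invmx uL.
apply: cvg_trans; apply: near_eq_cvg; have := near_unitmx uL ML.
by apply: filterS => t; rewrite /invmx => ->.
Qed.

End matrix_convergence.

Section matrix_measurability.
Context d (T : measurableType d) (R : realType).

Definition mx_measurable p q (M : T -> 'M[R]_(p, q)) :=
  forall i j, measurable_fun setT (fun t => M t i j).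

Lemma mx_measurable_sub p q (M N : T -> 'M[R]_(p, q)) :
  mx_measurable M -> mx_measurable N -> mx_measurable (fun t => M t - N t).
Proof.
move=> mM mN i j; rewrite (_ : (fun _ => _) = (fun t => M t i j - N t i j)).
  exact: measurable_funB.
by apply/funext => t; rewrite !mxE.
Qed.

Lemma mx_measurable_mul p q r (M : T -> 'M[R]_(p, q)) (N : T -> 'M[R]_(q, r)) :
  mx_measurable M -> mx_measurable N -> mx_measurable (fun t => M t *m N t).
Proof.
move=> mM mN i j.
rewrite (_ : (fun _ => _) = (fun t => \sum_k M t i k * N t k j)).
  by apply: measurable_sum => k; exact: measurable_funM.
by apply/funext => t; rewrite !mxE.
Qed.

Lemma measurable_det p (M : T -> 'M[R]_p) :
  mx_measurable M -> measurable_fun setT (fun t => \det (M t)).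
Proof.
move=> mM; apply: measurable_sum => s; apply: measurable_funM => //.
by apply: measurable_prod => i _; exact: mM.
Qed.

Lemma measurable_unitmx p (M : T -> 'M[R]_p) :
  mx_measurable M -> measurable [set t | M t \in unitmx].
Proof.
move=> /measurable_det md.
rewrite (_ : [set _ | _] = (fun t => \det (M t)) @^-1` (~` [set 0])).
  by rewrite -[X in measurable X]setTI; apply: md => //; exact: measurableC.
by apply/seteqP; split => t /=; rewrite unitmxE unitfE => /eqP.
Qed.

Lemma mx_measurable_scale p q (c : T -> R) (M : T -> 'M[R]_(p, q)) :
  measurable_fun setT c -> mx_measurable M -> mx_measurable (fun t => c t *: M t).
Proof.
move=> mc mM i j; rewrite (_ : (fun _ => _) = (fun t => c t * M t i j)).
  exact: measurable_funM.
by apply/funext => t; rewrite !mxE.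
Qed.

Lemma mx_measurable_adj p (M : T -> 'M[R]_p) :
  mx_measurable M -> mx_measurable (fun t => \adj (M t)).
Proof.
move=> mM i j; rewrite (_ : (fun _ => _) = (fun t => cofactor (M t) j i)).
  apply: measurable_funM => //; apply: measurable_det => k l.
  rewrite (_ : (fun _ => _) = (fun t => M t (lift j k) (lift i l))); first exact: mM.
  by apply/funext => t; rewrite !mxE.
by apply/funext => t; rewrite !mxE.
Qed.

End matrix_measurability.

Section vech_theory.
Variables (R : realType) (d : nat).

(** The dropped column meets only the dropped entry of [v], which is 0. For [v = vech A] this is
    where the restriction on the last diagonal entry enters. *)
Lemma droplast_col_mul p q (M : 'M[R]_(p, q)) (v : 'cV[R]_q) :
  (forall k : 'I_q, k.+1 = q -> v k ord0 = 0) ->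
  droplast_col M *m rowsub (widen_ord (leq_pred q)) v = M *m v.
Proof.
case: q M v => [|q] M v v0; apply/matrixP => i j; rewrite [j]ord1 !mxE.
  by rewrite !big_ord0.
rewrite [RHS]big_ord_recr /= [v ord_max _]v0// mulr0 addr0.
by apply: eq_bigr => k _; rewrite !mxE; congr (M i _ * v _ _); exact: val_inj.
Qed.

Lemma vech_last (A : 'M[R]_d) (k : 'I_(vech_dim d)) : (0 < d)%N ->
  FB_admissible A -> k.+1 = vech_dim d -> vech A k ord0 = 0.
Proof.
case: d A k => // n A k _ [At A0] kd.
rewrite (@vech_vech_pos _ _ A ord_max ord_max k At) ?A0//.
by rewrite vech_pos_diag//; exact: (esym (congr1 predn kd)).
Qed.

Lemma unvech'_vech' (A : 'M[R]_d) : (0 < d)%N -> FB_admissible A ->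
  unvech' (vech' A) = A.
Proof.
move=> d0 A_adm; apply/matrixP => i j; rewrite mxE.
have [At _] := A_adm; have lt := vech_pos_lt i j.
have [lt'|ge] := ltnP (vech_pos i j) (vech_dim d).-1.
  rewrite (nth_map (Ordinal lt')) ?size_enum_ord// mxE.
  apply: vech_vech_pos => //=.
  by rewrite nth_enum_ord.
(* The one position outside [vech'] is the last diagonal entry; the default 0 of [nth] is its
   prescribed value. *)
rewrite nth_default; last by rewrite size_map size_enum_ord.
rewrite -(@vech_vech_pos _ _ A i j (Ordinal lt) At)// vech_last//=.
have D0 : (0 < vech_dim d)%N by exact: leq_ltn_trans lt.
by apply/eqP; rewrite eqn_leq lt /= -(prednK D0) ltnS.
Qed.

End vech_theory.

Section summands.
Variables (R : realType) (d m : nat) (F : 'cV[R]_d -> 'cV[R]_m).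
Implicit Types y : 'cV[R]_d.

(** The summand of [stein_quad'], with the factor 2 and the column removal moved inside the average
    so that the strong law applies directly. *)
Definition quad'_op y : 'M[R]_(m, (vech_dim d).-1) :=
  droplast_col (2 *: (castmx (muln1 m, erefl) (tangent_grad F y *t y^T) *m dup_mx)).

Lemma stein_quad'E n (x : nat -> 'cV[R]_d) :
  stein_quad' F n x = sample_mean quad'_op n x.
Proof.
rewrite /stein_quad' /stein_quad /sample_mean /quad'_op.
have dropZ (c : R) (M : 'M[R]_(m, vech_dim d)) :
    droplast_col (c *: M) = c *: droplast_col M.
  by apply/matrixP => i j; rewrite !mxE.
rewrite !dropZ; under [in RHS]eq_bigr do rewrite dropZ.
rewrite -scaler_sumr !scalerA mulrC; congr (_ *: _).
by apply/matrixP => i j; rewrite mxE !summxE; apply: eq_bigr => k _; rewrite [RHS]mxE.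
Qed.

Lemma tens_row_coord y (i : 'I_m) (r : 'I_(d * d)) :
  castmx (muln1 m, erefl (d * d)%N) (tangent_grad F y *t y^T) i r =
  tangent_grad F y i (mxtens_unindex r).1 * y (mxtens_unindex r).2 ord0.
Proof.
rewrite castmxE cast_ord_id mxE [y^T _ _]mxE; congr (tangent_grad F y _ _ * y _ _).
  by apply: val_inj; rewrite /= divn1.
by rewrite ord1.
Qed.

(** The vec identity: the Kronecker product of [T] and [y^T], applied to [vec A], is [T A^T y]. It
    identifies the term in [vech' A] with the quadratic part of the score. *)
Lemma quad'_op_mul (A : 'M[R]_d) y : (0 < d)%N -> FB_admissible A ->
  quad'_op y *m vech' A = tangent_grad F y *m (2 *: (A *m y)).
Proof.
move=> d0 A_adm; have [At _] := A_adm.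
rewrite /quad'_op /vech' droplast_col_mul; last by move=> k; exact: vech_last.
rewrite -scalemxAl -mulmxA dup_mx_vech// -scalemxAr; congr (_ *: _).
apply/matrixP => i j; rewrite [j]ord1 mxE.
pose G a b := tangent_grad F y i a * y b ord0 * A b a.
transitivity (\sum_(r < d * d) G (mxtens_unindex r).1 (mxtens_unindex r).2).
  by apply: eq_bigr => r _; rewrite tens_row_coord /G [vec A _ _]mxE.
rewrite sum_mxtens mxE; apply: eq_bigr => a _.
rewrite [(A *m y) _ _]mxE mulr_sumr; apply: eq_bigr => b _.
have Aab : A b a = A a b by rewrite -[in LHS]At mxE.
by rewrite /G Aab; ring.
Qed.

Variable U : set 'cV[R]_d.
Hypothesis sF : forall i, smooth_on U (fun y => F y i ord0).

Lemma continuous_grad i j y : U y -> {for y, continuous (fun y => grad F y i j)}.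
Proof.
move=> Uy; rewrite (_ : (fun _ => _) = partial j (fun y => F y i ord0)).
  by have [_ /(_ j)[_ [+ _]]] := sF i 1; exact.
by apply/funext => z; rewrite mxE.
Qed.

Lemma continuous_partial2 i j k y : U y ->
  {for y, continuous (partial j (partial k (fun y => F y i ord0)))}.
Proof.
by move=> Uy; have [_ /(_ k)[_ [_ /(_ j)[_ [+ _]]]]] := sF i 2; exact.
Qed.

Lemma continuous_tangent_grad i j y :
  U y -> {for y, continuous (fun y => tangent_grad F y i j)}.
Proof.
move=> Uy; rewrite (_ : (fun _ => _) = (fun y => \sum_k grad F y i k *
    ((k == j)%:R - y k ord0 * y j ord0))); last first.
  apply/funext => z; rewrite mxE; apply: eq_bigr => k _.
  by rewrite !mxE big_ord1 mxE.
apply: (@cvg_bigsum _ _ (nbhs y)) => k _; apply: cvgM; first exact: continuous_grad.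
apply: cvgB; first exact: cvg_cst.
by apply: cvgM; exact: coord_continuous.
Qed.

Lemma continuous_quad'_op i j y :
  U y -> {for y, continuous (fun y => quad'_op y i j)}.
Proof.
move=> Uy; rewrite (_ : (fun _ => _) = (fun y => \sum_r
    (tangent_grad F y i (mxtens_unindex r).1 * y (mxtens_unindex r).2 ord0)
    * (2 * dup_mx r (widen_ord (leq_pred _) j)))); last first.
  apply/funext => z; rewrite mxE mxE mxE mulr_sumr; apply: eq_bigr => r _.
  by rewrite tens_row_coord; ring.
apply: (@cvg_bigsum _ _ (nbhs y)) => r _; apply: cvgM; last exact: cvg_cst.
apply: cvgM; first exact: continuous_tangent_grad.
exact: coord_continuous.
Qed.

Lemma continuous_stein_op i j y :
  U y -> {for y, continuous (fun y => stein_op F y i j)}.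
Proof.
move=> Uy; rewrite (_ : (fun _ => _) = (fun y =>
    \sum_k grad F y i k * y k ord0 * (d%:R - 1)
    + (\sum_r partial (mxtens_unindex r).2 (partial (mxtens_unindex r).1
         (fun y => F y i ord0)) y
       * (y (mxtens_unindex r).1 ord0 * y (mxtens_unindex r).2 ord0))
    - \sum_k partial k (partial k (fun y => F y i ord0)) y)); last first.
  apply/funext => z; rewrite [j]ord1 /stein_op.
  have E (a : R) (A B C : 'cV[R]_m) :
      (a *: A + B - C) i ord0 = a * A i ord0 + B i ord0 - C i ord0.
    by rewrite !mxE.
  rewrite E -mulr_suml mulrC; congr (_ * _ + _ - _); rewrite mxE//.
  by apply: eq_bigr => r _; rewrite !mxE !ord1.
have cc := @coord_continuous R d 1.
apply: continuousB; last by apply: (@cvg_bigsum _ _ (nbhs y)) => k _; exact: continuous_partial2.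
apply: continuousD.
  apply: (@cvg_bigsum _ _ (nbhs y)) => k _.
  apply: cvgM; last exact: cvg_cst.
  by apply: cvgM; [exact: continuous_grad|exact: cc].
apply: (@cvg_bigsum _ _ (nbhs y)) => r _; apply: cvgM; first exact: continuous_partial2.
by apply: cvgM; exact: cc.
Qed.

End summands.

(** * Sample means and expectations under the Fisher-Bingham law *)

Section sampling.
Variables (R : realType) (d : nat) (mu : 'cV[R]_d) (A : 'M[R]_d).
Variables (dO : measure_display) (Omega : measurableType dO).
Variables (P : probability Omega R) (X : nat -> {RV P >-> 'cV[R]_d}).
Hypothesis XS : forall i w, sphere (X i w).
Hypothesis Xind : mutually_independent X.
Hypothesis Xlaw : forall i (B : set 'cV[R]_d), measurable B ->
  distribution P (X i) B = FB mu A B.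
Variable U : set 'cV[R]_d.
Hypotheses (oU : open U) (SU : sphere `<=` U).

Lemma sample_mean_coord p q (k : 'cV[R]_d -> 'M[R]_(p, q)) n x i j :
  sample_mean k n x i j = n%:R^-1 * \sum_(l < n) k (x l) i j.
Proof. by rewrite /sample_mean mxE summxE. Qed.

Section summand.
Variables (p q : nat) (k : 'cV[R]_d -> 'M[R]_(p, q)).
Hypothesis ck : forall i j y, U y -> {for y, continuous (fun y => k y i j)}.

Lemma mx_measurable_sample_mean n :
  mx_measurable (fun w => sample_mean k n (fun i => X i w)).
Proof.
move=> i j; under eq_fun do rewrite sample_mean_coord.
apply: measurable_funM => //; apply: measurable_sum => l.
apply: (measurable_comp_sphere (g := fun y => k y i j) (XS l)).
exact: (continuous_measurable_sphere oU SU (@ck i j)).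
Qed.

Lemma mexpect_sample i j :
  mexpect P (fun w => sample_mean k 1 (fun i => X i w)) i j =
  (\int[P]_w k (X 0 w) i j)%R.
Proof.
rewrite mxE unlock; congr fine; apply: eq_integral => w _.
by rewrite sample_mean_coord big_ord1 invr1 mul1r.
Qed.

Lemma sample_mean_strong_law : {ae P, forall w,
  sample_mean k n (fun i => X i w) @[n --> \oo] -->
  mexpect P (fun w => sample_mean k 1 (fun i => X i w))}.
Proof.
suff H i j : {ae P, forall w,
    n%:R^-1 * \sum_(l < n) k (X l w) i j @[n --> \oo] -->
    (\int[P]_w k (X 0 w) i j)%R}.
  have : {ae P, forall w, forall i j, n%:R^-1 * \sum_(l < n) k (X l w) i j @[n --> \oo] -->
    (\int[P]_w k (X 0 w) i j)%R}.
    by apply: filter_forall => i; apply: filter_forall => j; exact: H.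
  apply: filterS => w Hw; apply/cvg_mxP => i j; rewrite mexpect_sample.
  by under eq_fun do rewrite sample_mean_coord; exact: Hw.
have mk := continuous_measurable_sphere oU SU (@ck i j).
have [M kM] := continuous_sphere_bounded (fun y Sy => @ck i j y (SU Sy)).
(* The strong law wants a bound on the whole space. The bound becomes [|M|] because [g] is 0 off the
   sphere and [M] is not known to be nonnegative. *)
pose g := (fun y => k y i j) \_ sphere.
have mg : measurable_fun setT g.
  by apply/(measurable_restrictT _ _).1 => //; exact: measurable_sphere.
have gX l w : g (X l w) = k (X l w) i j by rewrite /g patchE mem_set.
have gM y : `|g y| <= `|M|.
  rewrite /g patchE; case: ifPn => [/set_mem Sy|_]; last by rewrite normr0.
  by rewrite (le_trans (kM _ Sy))// ler_norm.
have := @strong_law_bounded _ _ _ P _ _ X g `|M| (\int[P]_w k (X 0 w) i j)%R Xind mg gM.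
have gE l : (\int[P]_w g (X l w) = \int[P]_w k (X 0 w) i j)%R.
  transitivity (\int[P]_w k (X l w) i j)%R.
    by apply: eq_Rintegral => w _; rewrite gX.
  by rewrite (Rintegral_FB (XS l) (Xlaw l) mk kM) (Rintegral_FB (XS 0) (Xlaw 0) mk kM).
move=> /(_ gE); apply: filterS => w.
by under eq_fun do under eq_bigr do rewrite gX.
Qed.

End summand.

(** Splitting [FB_score] into [mu] and [2 A y] separates the Stein identity into a term linear in
    [mu] and one linear in [vech' A]. *)
Lemma expectation_stein m (F : 'cV[R]_d -> 'cV[R]_m) : (0 < d)%N ->
  FB_admissible A -> (forall i, smooth_on U (fun y => F y i ord0)) ->
  mexpect P (fun w => stein_const F 1 (fun i => X i w)) =
  mexpect P (fun w => stein_lin F 1 (fun i => X i w)) *m mu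
  + mexpect P (fun w => stein_quad' F 1 (fun i => X i w)) *m vech' A.
Proof.
move=> d0 A_adm sF; have [At _] := A_adm.
have -> : (fun w => stein_quad' F 1 (fun i => X i w)) =
    (fun w => sample_mean (quad'_op F) 1 (fun i => X i w)).
  by apply/funext => w; exact: stein_quad'E.
apply/matrixP => i c; rewrite [c]ord1 [RHS]mxE [X in _ = X + _]mxE [X in _ = _ + X]mxE.
rewrite (mexpect_sample (stein_op F)).
under eq_bigr do rewrite (mexpect_sample (tangent_grad F)).
under [X in _ + X]eq_bigr do rewrite (mexpect_sample (quad'_op F)).
have bnd g : (forall y, U y -> {for y, continuous g}) ->
    P.-integrable setT (EFin \o (fun w => g (X 0 w))).
  move=> cg; have [M gM] := continuous_sphere_bounded (fun y Sy => cg y (SU Sy)).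
  apply: (@bounded_integrable _ _ _ _ _ M) => [|w]; last exact: gM.
  apply: measurable_comp_sphere; first exact: XS.
  exact: (continuous_measurable_sphere oU SU cg).
have cL i k := @continuous_tangent_grad _ _ _ _ _ sF i k.
have cQ i k := @continuous_quad'_op _ _ _ _ _ sF i k.
have cC k := @continuous_stein_op _ _ _ _ _ sF k ord0.
have iL k : P.-integrable setT (EFin \o (fun w => tangent_grad F (X 0 w) i k * mu k ord0)).
  apply: (bnd (fun y => tangent_grad F y i k * mu k ord0)) => y Uy.
  by apply: continuousM; [exact: cL|exact: cst_continuous].
have iQ k : P.-integrable setT (EFin \o (fun w => quad'_op F (X 0 w) i k * vech' A k ord0)).
  apply: (bnd (fun y => quad'_op F y i k * vech' A k ord0)) => y Uy.
  by apply: continuousM; [exact: cQ|exact: cst_continuous].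
have iC : P.-integrable setT (EFin \o (fun w => stein_op F (X 0 w) i ord0)).
  by apply: (bnd (fun y => stein_op F y i ord0)) => y; exact: cC.
have -> : \sum_k (\int[P]_w tangent_grad F (X 0 w) i k)%R * mu k ord0 =
    (\int[P]_w \sum_k tangent_grad F (X 0 w) i k * mu k ord0)%R.
  rewrite Rintegral_bigsum//; apply: eq_bigr => k _.
  by rewrite RintegralZr//; apply: (bnd (fun y => tangent_grad F y i k)) => y; exact: cL.
have -> : \sum_k (\int[P]_w quad'_op F (X 0 w) i k)%R * vech' A k ord0 =
    (\int[P]_w \sum_k quad'_op F (X 0 w) i k * vech' A k ord0)%R.
  rewrite Rintegral_bigsum//; apply: eq_bigr => k _.
  by rewrite RintegralZr//; apply: (bnd (fun y => quad'_op F y i k)) => y; exact: cQ.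
have iSL := integrable_bigsum (index_enum _) (P := xpredT) measurableT (fun k _ => iL k).
have iSQ := integrable_bigsum (index_enum _) (P := xpredT) measurableT (fun k _ => iQ k).
pose sL w := \sum_k tangent_grad F (X 0 w) i k * mu k ord0.
pose sQ w := \sum_k quad'_op F (X 0 w) i k * vech' A k ord0.
have iSLQ : P.-integrable setT (EFin \o (fun w => sL w + sQ w)).
  rewrite (_ : _ \o _ = ((EFin \o sL) \+ (EFin \o sQ))%E)//.
  exact: integrableD.
rewrite -RintegralD//; apply/eqP; rewrite -subr_eq0 -RintegralB//.
(* The difference of the two sides, gathered under one expectation, is the integrand of
   [Rintegral_FB_stein_op] without the kernel. *)
pose g y := (stein_op F y - tangent_grad F y *m FB_score mu A y) i ord0.
have gE y : stein_op F y i ord0 - (\sum_k tangent_grad F y i k * mu k ord0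
    + \sum_k quad'_op F y i k * vech' A k ord0) = g y.
  rewrite /g /FB_score mulmxDr -quad'_op_mul// [RHS]mxE [X in _ = _ + X]mxE.
  by congr (_ - _); rewrite [RHS]mxE; congr (_ + _); rewrite mxE.
apply/eqP; transitivity (\int[P]_w g (X 0 w))%R.
  by apply: eq_Rintegral => w _; rewrite gE.
have cg y : U y -> {for y, continuous g}.
  move=> Uy; rewrite (_ : g = (fun y => stein_op F y i ord0 -
    (\sum_k tangent_grad F y i k * mu k ord0
    + \sum_k quad'_op F y i k * vech' A k ord0))); last by apply/funext => z; rewrite gE.
  apply: continuousB; first exact: cC.
  apply: continuousD; apply: (@cvg_bigsum _ _ (nbhs y)) => k _.
    by apply: cvgM; [exact: cL|exact: cvg_cst].
  by apply: cvgM; [exact: cQ|exact: cvg_cst].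
have [M gM] := continuous_sphere_bounded (fun y Sy => cg y (SU Sy)).
rewrite (Rintegral_FB (XS 0) (Xlaw 0) (continuous_measurable_sphere oU SU cg) gM).
by rewrite (Rintegral_FB_stein_op mu At oU SU (sF i)) mulr0.
Qed.

End sampling.

Lemma cvg_unvech' (R : realType) (d : nat) (T : Type) (F : set_system T)
    {FF : ProperFilter F} (v : T -> 'cV[R]_(vech_dim d).-1) (l : 'cV[R]_(vech_dim d).-1) :
  v t @[t --> F] --> l -> unvech' (v t) @[t --> F] --> unvech' l.
Proof.
move=> /cvg_mxP vl; apply/cvg_mxP => i j; rewrite mxE.
under eq_fun do rewrite mxE.
have [lt|ge] := ltnP (vech_pos i j) (vech_dim d).-1.
  rewrite (nth_map (Ordinal lt)) ?size_enum_ord//.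
  under eq_fun do rewrite (nth_map (Ordinal lt)) ?size_enum_ord//.
  exact: vl.
rewrite nth_default; last by rewrite size_map size_enum_ord.
under eq_fun do [rewrite nth_default; last by rewrite size_map size_enum_ord].
exact: cvg_cst.
Qed.

(* The left-hand side is polynomial in the entries, hence measurable in them. *)
Lemma schur_unitmx (K : fieldType) p q (M : 'M[K]_p) (L : 'M[K]_q)
    (G : 'M[K]_(q, p)) (E : 'M[K]_(p, q)) : M \in unitmx ->
  (\det M *: L - G *m \adj M *m E \in unitmx) =
  (L - G *m invmx M *m E \in unitmx).
Proof.
move=> uM; have uD : \det M \is a GRing.unit by rewrite -unitmxE.
rewrite -[RHS](unitmxZ _ uD) scalerBr /invmx uM.
by rewrite -scalemxAr -scalemxAl scalerA divrr// scale1r.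
Qed.

(** The events that [B k] holds for all [k >= n] increase with [n] to a set of probability one, and
    each is contained in [B n]; continuity from below and a squeeze conclude. *)
Lemma cvg_probability_eventually d (T : measurableType d) (R : realType)
    (P : probability T R) (B : nat -> set T) : (forall n, measurable (B n)) ->
  {ae P, forall w, exists N : nat, forall n, (N <= n)%N -> B n w} ->
  P (B n) @[n --> \oo] --> 1%E.
Proof.
move=> mB [N [mN N0 NB]].
pose C n := \bigcap_(k in [set k | (n <= k)%N]) B k.
have mC n : measurable (C n) by exact: bigcap_measurableType.
have ndC : nondecreasing_seq C.
  move=> m n mn; apply/subsetPset => w Cw k /= nk; apply: Cw => /=.
  exact: leq_trans nk.
have mUC : measurable (\bigcup_n C n) by exact: bigcup_measurable.
have UC1 : P (\bigcup_n C n) = 1%E.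
  have C0 : P (~` \bigcup_n C n) = 0%E.
    apply: (subset_measure0 (measurableC mUC) mN _ N0) => w nC; apply: NB.
    move=> [n0 Bw]; apply: nC; exists n0 => // k /= n0k; exact: Bw.
  by rewrite -[X in P X]setCK probability_setC ?C0 ?sube0//; exact: measurableC.
have CP : P (C n) @[n --> \oo] --> 1%E.
  by rewrite -UC1; exact: nondecreasing_cvg_mu.
apply: (squeeze_cvge _ CP (cvg_cst 1%E)).
apply: nearW => n; rewrite probability_le1// andbT le_measure ?inE//.
by move=> w; apply => /=.
Qed.

Theorem theorem2p2 (R : realType) (d : nat) (hd : (2 <= d)%N)
    (mu0 : 'cV[R]_d) (A0 : 'M[R]_d) (hA0 : FB_admissible A0)
    (dO : measure_display) (Omega : measurableType dO) (P : probability Omega R)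
    (X : nat -> {RV P >-> 'cV[R]_d})
    (hXS : forall i w, sphere (X i w))
    (hXind : mutually_independent X)
    (hXlaw : forall i (B : set 'cV[R]_d), measurable B ->
       distribution P (X i) B = FB mu0 A0 B)
    (f1 F1 : 'cV[R]_d -> 'cV[R]_d)
    (f2 F2 : 'cV[R]_d -> 'cV[R]_(vech_dim d).-1)
    (hF1 : smooth_extension f1 F1) (hF2 : smooth_extension f2 F2) :
  let obs (w : Omega) : nat -> 'cV[R]_d := fun i => X i w in
  let EM1' := mexpect P (fun w => stein_quad' F2 1 (obs w)) in
  let EE1 := mexpect P (fun w => stein_lin F2 1 (obs w)) in
  let EG1' := mexpect P (fun w => stein_quad' F1 1 (obs w)) in
  let EL1 := mexpect P (fun w => stein_lin F1 1 (obs w)) in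
  EM1' \in unitmx ->
  EL1 - EG1' *m invmx EM1' *m EE1 \in unitmx ->
  [/\ forall n, measurable [set w | stein_exists F1 F2 n (obs w)],
      P [set w | stein_exists F1 F2 n (obs w)] @[n --> \oo] --> 1%E
    & exists Omega' : set Omega,
      [/\ measurable Omega', P Omega' = 1%E
        & forall w, Omega' w ->
          (exists N : nat, forall n, (N <= n)%N -> stein_exists F1 F2 n (obs w)) /\
          (stein_mu F1 F2 n (obs w), stein_A F1 F2 n (obs w)) @[n --> \oo]
            --> (mu0, A0)]].
Proof.
move=> obs EM1' EE1 EG1' EL1 uM uS.
have d0 : (0 < d)%N by exact: leq_trans hd.
case: hF1 => U1 [oU1 SU1 _ sF1]; case: hF2 => U2 [oU2 SU2 _ sF2].
pose M n w := stein_quad' F2 n (obs w).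
pose D n w := stein_const F2 n (obs w).
pose E n w := stein_lin F2 n (obs w).
pose G n w := stein_quad' F1 n (obs w).
pose H n w := stein_const F1 n (obs w).
pose L n w := stein_lin F1 n (obs w).
have quadE m (F : 'cV[R]_d -> 'cV[R]_m) n w :
  stein_quad' F n (obs w) = sample_mean (quad'_op F) n (fun i => X i w).
  exact: stein_quad'E.
have law m (F : 'cV[R]_d -> 'cV[R]_m) (U : set 'cV[R]_d) : open U -> sphere `<=` U ->
    (forall i, smooth_on U (fun y => F y i ord0)) ->
  {ae P, forall w,
    [/\ stein_quad' F n (obs w) @[n --> \oo] --> mexpect P (fun w => stein_quad' F 1 (obs w)),
        stein_const F n (obs w) @[n --> \oo] --> mexpect P (fun w => stein_const F 1 (obs w)) &
        stein_lin F n (obs w) @[n --> \oo] --> mexpect P (fun w => stein_lin F 1 (obs w))]}.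
  move=> oU SU sF.
  have HQ := sample_mean_strong_law hXS hXind hXlaw oU SU (continuous_quad'_op sF).
  have HC := sample_mean_strong_law hXS hXind hXlaw oU SU (continuous_stein_op sF).
  have HT := sample_mean_strong_law hXS hXind hXlaw oU SU (continuous_tangent_grad sF).
  apply: filterS3 HQ HC HT => w Q C T; split=> //.
  have -> : (fun w => stein_quad' F 1 (obs w)) =
      (fun w => sample_mean (quad'_op F) 1 (fun i => X i w)).
    by apply/funext => w'; exact: quadE.
  by under eq_fun do rewrite quadE.
have meas m (F : 'cV[R]_d -> 'cV[R]_m) (U : set 'cV[R]_d) n : open U -> sphere `<=` U ->
    (forall i, smooth_on U (fun y => F y i ord0)) ->
  mx_measurable (fun w => stein_quad' F n (obs w)) /\
  mx_measurable (fun w => stein_lin F n (obs w)).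
  move=> oU SU sF; split.
    under eq_fun do rewrite quadE.
    exact: (mx_measurable_sample_mean hXS oU SU (continuous_quad'_op sF)).
  exact: (mx_measurable_sample_mean hXS oU SU (continuous_tangent_grad sF)).
have mB n : measurable [set w | stein_exists F1 F2 n (obs w)].
  have [mM mE] := meas _ F2 U2 n oU2 SU2 sF2.
  have [mG mL] := meas _ F1 U1 n oU1 SU1 sF1.
  (* [invmx] is defined by cases; on the first event [schur_unitmx] trades it for an expression
     polynomial in the entries. *)
  rewrite (_ : [set _ | _] = [set w | M n w \in unitmx] `&`
    [set w | \det (M n w) *: L n w - G n w *m \adj (M n w) *m E n w \in unitmx]).
    apply: measurableI; apply: measurable_unitmx => //.
    apply: mx_measurable_sub.
      by apply: mx_measurable_scale => //; exact: measurable_det.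
    apply: mx_measurable_mul => //; apply: mx_measurable_mul => //.
    exact: mx_measurable_adj.
  apply/seteqP; split => w /=; rewrite /stein_exists.
    by move=> /andP[uMw uSw]; split=> //; rewrite schur_unitmx.
  by move=> [uMw]; rewrite schur_unitmx// => uSw; apply/andP.
have algF m (F : 'cV[R]_d -> 'cV[R]_m) U (oU : open U) (SU : sphere `<=` U) sF :=
  @expectation_stein R d mu0 A0 dO Omega P X hXS hXlaw U oU SU m F d0 hA0 sF.
pose ED1 := mexpect P (fun w => stein_const F2 1 (obs w)).
pose EH1 := mexpect P (fun w => stein_const F1 1 (obs w)).
have ED1E : ED1 = EE1 *m mu0 + EM1' *m vech' A0 by exact: algF oU2 SU2 sF2.
have EH1E : EH1 = EL1 *m mu0 + EG1' *m vech' A0 by exact: algF oU1 SU1 sF1.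
(* Block elimination: subtracting [EG1' *m invmx EM1'] times the first equation from the second
   removes [vech' A0] and leaves the Schur complement applied to [mu0]. *)
have mu0E : invmx (EL1 - EG1' *m invmx EM1' *m EE1) *m
    (EH1 - EG1' *m invmx EM1' *m ED1) = mu0.
  have -> : EG1' *m invmx EM1' *m ED1 =
      EG1' *m invmx EM1' *m EE1 *m mu0 + EG1' *m vech' A0.
    rewrite ED1E mulmxDr mulmxA; congr (_ + _).
    by rewrite -mulmxA mulKmx.
  by rewrite EH1E opprD addrACA subrr addr0 -mulmxBl mulKmx.
have A0E : unvech' (invmx EM1' *m (ED1 - EE1 *m mu0)) = A0.
  by rewrite ED1E addrAC subrr add0r mulKmx// unvech'_vech'.
have good : {ae P, forall w,
    (exists N : nat, forall n, (N <= n)%N -> stein_exists F1 F2 n (obs w)) /\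
    (stein_mu F1 F2 n (obs w), stein_A F1 F2 n (obs w)) @[n --> \oo] --> (mu0, A0)}.
  apply: filterS2 (law _ F2 U2 oU2 SU2 sF2) (law _ F1 U1 oU1 SU1 sF1).
  move=> w [cM cD cE] [cG cH cL].
  have cGV : G n w *m invmx (M n w) @[n --> \oo] --> EG1' *m invmx EM1'.
    by apply: cvg_mulmx => //; exact: cvg_invmx.
  have cS : L n w - G n w *m invmx (M n w) *m E n w @[n --> \oo] -->
      EL1 - EG1' *m invmx EM1' *m EE1.
    by apply: cvgB => //; exact: cvg_mulmx.
  have cmu : stein_mu F1 F2 n (obs w) @[n --> \oo] --> mu0.
    rewrite -[X in _ --> X]mu0E; apply: cvg_mulmx; first exact: cvg_invmx.
    by apply: cvgB => //; exact: cvg_mulmx.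
  split.
    have [N _ NP] := filterI (near_unitmx uM cM) (near_unitmx uS cS).
    by exists N => n Nn; apply/andP; exact: NP.
  have cA : stein_A F1 F2 n (obs w) @[n --> \oo] --> A0.
    rewrite -[X in _ --> X]A0E; apply: cvg_unvech'.
    apply: cvg_mulmx; first exact: cvg_invmx.
    by apply: cvgB => //; exact: cvg_mulmx.
  exact: cvg_pair cmu cA.
split=> //.
  apply: cvg_probability_eventually => //.
  by apply: filterS good => w [].
(* [N] is a measurable null set containing every failure, so its complement serves as [Omega']. *)
have [N [mN N0 NP]] := good.
exists (~` N); split; first exact: measurableC.
  by rewrite probability_setC// N0 sube0.
by move=> w nNw; apply: contrapT => nw; apply: nNw; exact: NP.
Qed.
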